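(* Let $f=\frac1N\sum_{i=1}^N f_i$ with minimizer $x^*$, where each $f_i:\mathbb{R}^d\to\mathbb{R}$ is convex and $L$-smooth and $f$ is $\mu$-strongly convex; let $\kappa=L/\mu$. Suppose $\kappa\le\frac{n^{1-2\delta}}{32}$ with a constant $0<\delta<\frac12$, and that in the DSVRG algorithm (described in the context) one chooses $$\eta=\frac{1}{16n^\delta L},\qquad T=n,\qquad K=\frac{1}{\log(n^\delta/2)}\log\left(\frac{f(\tilde x^0)-f(x^* )}{\epsilon}\right),$$ where $n^\delta>2$. Suppose also that $\tilde n\ge cn$ for a universal constant $c>0$ and $TK=Q\le\tilde n m$. Then DSVRG finds an $\epsilon$-optimal solution of $\min_x f(x)$ with $O\left(\frac{\log(1/\epsilon)}{\delta\log n}\right)$ rounds of communication, $O\left(\frac{n\log(1/\epsilon)}{\delta\log n}\right)$ total parallel runtime, and $O\left(\frac{m\log(1/\epsilon)}{\delta\log n}\right)$ amount of communication. In particular, when $\epsilon=\frac{1}{n^s}$ with a positive constant $s$, DSVRG finds an $\epsilon$-optimal solution with $O(1)$ rounds of communication, $O(n)$ total parallel runtime, and $O(m)$ amount of communication.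
   Context: Setting. $N=mn$ with positive integers $m\ll n$; $m$ is the number of machines. Norms are Euclidean. $f_i$ is $L$-smooth if it is differentiable with $\|\nabla f_i(x)-\nabla f_i(y)\|\le L\|x-y\|$ for all $x,y$. The convex function $f=\frac1N\sum_i f_i$ is $\mu$-strongly convex ($\mu>0$): $\|\nabla f(x)-\nabla f(y)\|\ge\mu\|x-y\|$ for all $x,y$. $x^*$ is the unique minimizer of $f$. A random $\hat x$ is $\epsilon$-optimal if $\mathbb{E}[f(\hat x)-f(x^* )]\le\epsilon$. Each machine can store at most $C$ of the functions, with $n<C<N$, and $\tilde n:=C-n\ge cn$ for a universal constant $c>0$. DSVRG algorithm. Inputs: $\tilde x^0\in\mathbb{R}^d$, $\eta$, positive integers $T,K$, and $Q=TK$. (1) Data allocation: produce a random partition $S_1,\dots,S_m$ of $[N]=\{1,\dots,N\}$ with $|S_j|=n$, and indices $r_1,\dots,r_Q$ that are i.i.d. uniform on $[N]$. With $J=\lceil Q/\tilde n\rceil$, define multi-sets $R_j=\{r_{(j-1)\tilde n+1},\dots,r_{j\tilde n}\}$ for $j<J$, $R_J=\{r_{(J-1)\tilde n+1},\dots,r_Q\}$, and $R_j=\emptyset$ for $j>J$. Machine $j$ stores $\{f_i: i\in S_j\cup R_j\}$. Set the active machine index $k\leftarrow1$. (2) For each stage $\ell=0,1,\dots,K-1$: the center sends $\tilde x^\ell$ to all machines; the machines compute in parallel $h_j^\ell=\sum_{i\in S_j}\nabla f_i(\tilde x^\ell)$ and send it to the center; the center forms $h^\ell=\frac1N\sum_{j=1}^m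 h_j^\ell$ and sends it to machine $k$. Then the single-stage procedure SS-SVRG is run: set $x_0=\tilde x^\ell$, $\bar x_0=0$; for $t=0,\dots,T-1$, machine $k$ samples an element $i$ from $R_k$, sets $$x_{t+1}=x_t-\eta\left(\nabla f_i(x_t)-\nabla f_i(\tilde x^\ell)+h^\ell\right),\qquad \bar x_{t+1}=\frac{x_{t+1}+t\bar x_t}{t+1},$$ and removes (one copy of) $i$ from $R_k$; if $R_k$ becomes empty, $x_{t+1},\bar x_{t+1}$ are sent to machine $k+1$ and $k\leftarrow k+1$. Finally $\tilde x^{\ell+1}=\bar x_T$. (3) Output $\tilde x^K$. The prescribed $K$ is understood to be a positive integer. Performance metrics. Parallel runtime: the longest time spent by the machines in local computation, measured in number of gradient evaluations $\nabla f_i(x)$ (batch gradient computations run in parallel over machines, the iterative updates run serially). Amount of communication: total number of vectors in $\mathbb{R}^d$ transmitted among the machines and the center during step (2) (the initial data allocation is accounted for separately). Rounds of communication: number of times the machines pause local computation to exchange messages: a bounded number per batch gradient computation, plus one for each hand-over from machine $k$ to machine $k+1$. The notation $O(\cdot)$ is asymptotic as $n\to\infty$ and $\epsilon\to0$, with $c$, $\delta$, $s$ and the initial optimality gap $f(\tilde x^0)-f(x^* )$ treated as constants. *)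

(* Defs.v *)
From HB Require Import structures.
From mathcomp Require Import all_boot all_order all_algebra.
From mathcomp Require Import all_classical all_reals all_analysis.

Set Implicit Arguments.
Unset Strict Implicit.
Unset Printing Implicit Defensive.
Import Order.TTheory GRing.Theory Num.Theory.
Import numFieldNormedType.Exports.

Local Open Scope ring_scope.

Section Objective.
Context {R : realType} {d : nat}.
Implicit Types (f : 'rV[R]_d -> R) (x y v : 'rV[R]_d).

(* The library norm of ['rV[R]_d] is the sup norm, so the Euclidean norm is
   introduced separately. *)
Definition enorm v : R := Num.sqrt (\sum_i v ord0 i ^+ 2).

Definition grad f x : 'rV[R]_d :=
  \row_i 'D_(delta_mx ord0 i) (f : 'rV[R]_d -> R^o) x.

Definition convex f : Prop :=
  convex_function [set: convex_lmodType 'rV[R]_d] (f : _ -> R^o).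

Definition smooth (L : R) f : Prop :=
  (forall x, differentiable (f : 'rV[R]_d -> R^o) x) /\
  (forall x y, enorm (grad f x - grad f y) <= L * enorm (x - y)).

Definition strongly_convex (mu : R) f : Prop :=
  [/\ 0 < mu, convex f &
      forall x y, mu * enorm (x - y) <= enorm (grad f x - grad f y)].

Definition is_minimizer f x : Prop := forall y, f x <= f y.

Definition average (N : nat) (F : 'I_N -> 'rV[R]_d -> R) x : R :=
  N%:R^-1 * \sum_i F i x.

End Objective.

(* Finitely supported distributions, as lists of weighted outcomes; an outcome
   may be listed several times. All weights produced by [dret], [dbind] and
   [duniform] are positive, so [surely] is a statement about every outcome of
   positive probability. *)
Definition dist (R : realType) (A : Type) : Type := seq (R * A).

Section Distributions.
Context {R : realType}.

Definition dret (A : Type) (a : A) : dist R A := [:: (1, a)].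

Definition dbind (A B : Type) (D : dist R A) (k : A -> dist R B) : dist R B :=
  flatten [seq [seq (wa.1 * wb.1, wb.2) | wb <- k wa.2] | wa <- D].

(* On a list with repetitions, each occurrence is equally likely. *)
Definition duniform (A : Type) (s : seq A) : dist R A :=
  [seq ((size s)%:R^-1, a) | a <- s].

Definition dexpectation (A : Type) (D : dist R A) (g : A -> R) : R :=
  \sum_(wa <- D) wa.1 * g wa.2.

Definition surely (A : Type) (D : dist R A) (P : pred A) : bool :=
  all (fun wa => P wa.2) D.

(* [body (T-1)] after ... after [body 0], started from [a]. *)
Fixpoint iterate (A : Type) (body : nat -> A -> dist R A) (T : nat) (a : A) :
    dist R A :=
  if T is t.+1 then dbind (iterate body t a) (body t) else dret a.

Definition eps_optimal (d : nat) (f : 'rV[R]_d -> R) (xstar : 'rV[R]_d)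
    (eps : R) (X : dist R 'rV[R]_d) : Prop :=
  dexpectation X (fun x => f x - f xstar) <= eps.

End Distributions.

(* Machines are numbered from 0. [pools] holds the current multisets R_j, as
   lists up to order; [active] is the index k. The last three fields are the
   performance counters: rounds of communication, parallel runtime (in gradient
   evaluations, as the maximum over the machines for the parallel parts) and
   number of vectors transmitted. *)
Record state (R : realType) (d N : nat) := State {
  center  : 'rV[R]_d;
  iterate_point : 'rV[R]_d;
  running_average : 'rV[R]_d;
  pools   : seq (seq 'I_N);
  active  : nat;
  rounds  : nat;
  runtime : nat;
  vectors : nat
}.

Section DSVRG.
Context {R : realType} {d : nat}.
Variables (m n : nat).
(* [C]: storage capacity of a machine; [b]: rounds of communication used by one
   batch gradient computation. *)
Variables (C b : nat).
Variables (F : 'I_(m * n) -> 'rV[R]_d -> R).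
Variables (eta : R) (T K : nat) (x0 : 'rV[R]_d).

Local Notation state := (state R d (m * n)).

(* An ordered partition (S_1, ..., S_m) of the index set into blocks of size n,
   given by the map sending an index to the number of its block. *)
Definition block (a : {ffun 'I_(m * n) -> 'I_m}) (j : 'I_m) :
    {set 'I_(m * n)} := [set i | a i == j].

(* Nonempty as soon as m > 0. *)
Definition partitions : seq {ffun 'I_(m * n) -> 'I_m} :=
  enum [pred a | [forall j, #|block a j| == n]].

(* Consecutive slices of length C - n of r_1, ..., r_Q. With J the ceiling of
   Q / (C - n), slice number J - 1 may be shorter and later ones are empty. *)
Definition initial_pools (r : seq 'I_(m * n)) : seq (seq 'I_(m * n)) :=
  mkseq (fun j => take (C - n) (drop (j * (C - n)) r)) m.

Definition svrg_step (h : 'rV[R]_d) (t : nat) (st : state) : dist R state :=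
  let k := active st in
  let Rk := nth [::] (pools st) k in
  (* The multiset of the active machine is never empty when T * K is at most
     m * (C - n). Otherwise the step is skipped, which keeps total mass 1. *)
  if nilp Rk then dret st else
  dbind (duniform Rk) (fun i =>
    let x := iterate_point st
      - eta *: (grad (F i) (iterate_point st) - grad (F i) (center st) + h) in
    let xbar := t.+1%:R^-1 *: (x + t%:R *: running_average st) in
    let Rk' := rem i Rk in
    (* A hand-over transmits x and xbar. Exhausting the last nonempty pool also
       counts as a hand-over, so J hand-overs are charged in total. *)
    let handover : bool := nilp Rk' in
    dret (State (center st) x xbar (set_nth [::] (pools st) k Rk')
           (k + handover)
           (rounds st + handover)
           (runtime st + 2)
           (vectors st + 2 * handover))).

Definition batch_gradient (a : {ffun 'I_(m * n) -> 'I_m}) (x : 'rV[R]_d) :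
    'rV[R]_d :=
  (m * n)%:R^-1 *: \sum_(j < m) \sum_(i in block a j) grad (F i) x.

Definition stage (a : {ffun 'I_(m * n) -> 'I_m}) (l : nat) (st : state) :
    dist R state :=
  let x := center st in
  (* m copies of the center are sent out, m partial sums come back, and h is
     sent to the active machine. *)
  let st0 := State x x 0 (pools st) (active st)
    (rounds st + b)
    (runtime st + \max_(j < m) #|block a j|)
    (vectors st + (m + m + 1)) in
  dbind (iterate (svrg_step (batch_gradient a x)) T st0) (fun st' =>
    dret (State (running_average st') (iterate_point st') (running_average st')
      (pools st') (active st') (rounds st') (runtime st') (vectors st'))).

Definition dsvrg : dist R state :=
  dbind (duniform partitions) (fun a =>
  dbind (duniform (enum {: (T * K).-tuple 'I_(m * n)})) (fun r =>
  iterate (stage a) K (State x0 x0 0 (initial_pools r) 0 0 0 0))).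

Definition dsvrg_output : dist R 'rV[R]_d :=
  dbind dsvrg (fun st => dret (center st)).

End DSVRG.

(* Main.v *)
Require Import Defs.
From mathcomp Require Import all_boot all_order all_algebra.
From mathcomp Require Import all_classical all_reals all_analysis.
From mathcomp Require Import perm ring lra zify.
Import Order.TTheory GRing.Theory Num.Theory.
Import numFieldNormedType.Exports.
Local Open Scope ring_scope.

(* Samples drawn without replacement from pools of i.i.d. uniform indices are
   again i.i.d. uniform: only the multiset of remaining indices matters, so by
   exchangeability the next sample may be taken to be the first unused index.
   Hence DSVRG has the law of SVRG with independent samples.  One stage of the
   latter contracts the expected gap g by 2 n^-delta, because
   |x_t - x*|^2 + alpha (t g(xbar_t) - g(x_t)) + (T - t) beta g(x_0),
   with alpha = 2 eta (1 - 2 L eta) and beta = 4 L eta^2, is a supermartingale.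
   Each hand-over empties a pool, which bounds the number of rounds. *)

Set Implicit Arguments.
Unset Strict Implicit.
Unset Printing Implicit Defensive.


(** * Euclidean inner product and directional derivatives *)

Section Euclidean.
Context {R : realType} {d : nat}.
Implicit Types u v w : 'rV[R]_d.

(** The argument runs backwards on observables instead of forwards on distributions: every
    transition acts on real functions of the state, and a bound is a potential that the transitions
    push down. The obstacle is that, once the tuple of indices is fixed, a draw from a pool is
    neither uniform on the whole index set nor independent of earlier draws; independence only
    appears after averaging over the tuple. The comparison therefore keeps that average outermost
    and is a chain of exact identities between finite sums over tuples. The counters are left out of
    it, as they are bounded on every outcome separately. Strong convexity is given as a lower bound
    on gradient differences. The growth inequality derived from it has the constant 6 in place of
    the classical 2, and the 32 in the condition number bound leaves room for this. *)

Definition dot u v : R := \sum_i u ord0 i * v ord0 i.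

Lemma dotC u v : dot u v = dot v u.
Proof. by apply: eq_bigr => i _; rewrite mulrC. Qed.

Lemma dotDl u v w : dot (u + v) w = dot u w + dot v w.
Proof. by rewrite -big_split; apply: eq_bigr => i _; rewrite mxE mulrDl. Qed.

Lemma dotZl a u w : dot (a *: u) w = a * dot u w.
Proof. by rewrite /dot mulr_sumr; apply: eq_bigr => i _; rewrite mxE mulrA. Qed.

Lemma dotNl u w : dot (- u) w = - dot u w.
Proof. by rewrite -scaleN1r dotZl mulN1r. Qed.

Lemma dotDr u v w : dot w (u + v) = dot w u + dot w v.
Proof. by rewrite !(dotC w) dotDl. Qed.

Lemma dotZr a u w : dot w (a *: u) = a * dot w u.
Proof. by rewrite !(dotC w) dotZl. Qed.

Lemma dotNr u w : dot w (- u) = - dot w u.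
Proof. by rewrite !(dotC w) dotNl. Qed.

Definition dotE := (dotDl, dotDr, dotZl, dotZr, dotNl, dotNr).

Lemma dot0l u : dot 0 u = 0.
Proof. by rewrite -(scale0r 0) dotZl mul0r. Qed.

Lemma dot_suml (I : finType) (U : I -> 'rV[R]_d) w :
  dot (\sum_i U i) w = \sum_i dot (U i) w.
Proof.
by elim/big_rec2: _ => [|i a b _ <-]; rewrite ?dot0l // dotDl.
Qed.

Lemma dot_ge0 u : 0 <= dot u u.
Proof. by apply: sumr_ge0 => i _; rewrite -expr2 sqr_ge0. Qed.

Lemma dot_eq0 u : dot u u = 0 -> u = 0.
Proof.
move=> /eqP; rewrite psumr_eq0 => [/allP u0|i _]; last by rewrite -expr2 sqr_ge0.
apply/rowP => i; rewrite mxE; apply/eqP.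
by have := u0 i (mem_index_enum _); rewrite /= mulf_eq0 orbb.
Qed.

Lemma enormE u : enorm u = Num.sqrt (dot u u).
Proof. by rewrite /enorm; congr Num.sqrt; apply: eq_bigr => i _; rewrite expr2. Qed.

Lemma sqr_enorm u : enorm u ^+ 2 = dot u u.
Proof. by rewrite enormE sqr_sqrtr // dot_ge0. Qed.

Lemma enorm_ge0 u : 0 <= enorm u.
Proof. by rewrite enormE sqrtr_ge0. Qed.

Lemma enormZ a u : enorm (a *: u) = `|a| * enorm u.
Proof. by rewrite !enormE !dotE mulrA -expr2 sqrtrM ?sqr_ge0 // sqrtr_sqr. Qed.

Lemma enorm0 : enorm (0 : 'rV[R]_d) = 0.
Proof. by rewrite enormE dot0l sqrtr0. Qed.

Lemma enorm_eq0 u : enorm u = 0 -> u = 0.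
Proof. by move=> u0; apply: dot_eq0; rewrite -sqr_enorm u0 expr0n. Qed.

Lemma dot_le_enorm u v : dot u v <= enorm u * enorm v.
Proof.
have [/eqP /dot_eq0 ->|u0] := boolP (dot u u == 0).
  by rewrite dot0l enorm0 mul0r.
have up : 0 < dot u u by rewrite lt_def u0 dot_ge0.
have := dot_ge0 (dot u u *: v - dot u v *: u); rewrite !dotE (dotC v u).
rewrite (_ : _ + _ = dot u u * (dot u u * dot v v - dot u v ^+ 2)); last by ring.
rewrite pmulr_rge0 // subr_ge0 => /ler_wsqrtr.
rewrite sqrtr_sqr sqrtrM ?dot_ge0 // -!enormE.
exact/le_trans/ler_norm.
Qed.

Lemma enormD u v : enorm (u + v) <= enorm u + enorm v.
Proof.
rewrite -(@ler_pXn2r _ 2) ?nnegrE ?addr_ge0 ?enorm_ge0 //.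
rewrite sqrrD !sqr_enorm !dotE (dotC v u); have := dot_le_enorm u v; lra.
Qed.

Lemma enorm_sum (I : finType) (U : I -> 'rV[R]_d) :
  enorm (\sum_i U i) <= \sum_i enorm (U i).
Proof.
elim/big_rec2: _ => [|i a b _ ab]; first by rewrite enorm0.
by rewrite (le_trans (enormD _ _)) // lerD2l.
Qed.

End Euclidean.

Section Gradient.
Context {R : realType} {d : nat}.
Implicit Types (f : 'rV[R]_d -> R) (x y v : 'rV[R]_d).

Lemma derive_grad f x v : differentiable (f : 'rV[R]_d -> R^o) x ->
  'D_v (f : 'rV[R]_d -> R^o) x = dot (grad f x) v.
Proof.
move=> df; rewrite deriveE // [in LHS](row_sum_delta v) linear_sum.
by apply: eq_bigr => i _; rewrite linearZ /= mxE -deriveE // mulrC.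
Qed.

Lemma is_derive_line f x v (s : R) :
    differentiable (f : 'rV[R]_d -> R^o) (x + s *: v) ->
  is_derive s 1 ((fun r => f (x + r *: v)) : R -> R^o)
    (dot (grad f (x + s *: v)) v).
Proof.
move=> df; rewrite -derive_grad //.
have [dfv _] := derivableP (@diff_derivable _ _ _ _ _ v df).
have quotientE : (fun h : R => h^-1 *:
      ((((fun r => f (x + r *: v)) : R -> R^o) \o shift s) (h *: (1 : R^o))
       - (f (x + s *: v) : R^o))) =
    (fun h => h^-1 *: (((f : 'rV[R]_d -> R^o) \o shift (x + s *: v)) (h *: v)
       - (f (x + s *: v) : R^o))).
  apply/funext => h /=; rewrite (_ : x + _ *: v = h *: v + (x + s *: v)) //.
  by rewrite [h *: 1]mulr1 scalerDl addrCA.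
by apply: DeriveDef; [rewrite /derivable quotientE|rewrite /derive quotientE].
Qed.

End Gradient.


(** * First-order inequalities for smooth convex functions *)

Section SmoothConvex.
Context {R : realType} {d : nat}.
Implicit Types (f : 'rV[R]_d -> R) (x y v : 'rV[R]_d) (L : R).

(** The mean value theorem stands in for integration: once the quadratic is subtracted,
    Cauchy-Schwarz and the Lipschitz gradient keep the derivative along the segment below its value
    at the start. *)
Lemma smooth_le f L x y : smooth L f ->
  f y <= f x + dot (grad f x) (y - x) + L / 2 * dot (y - x) (y - x).
Proof.
move=> [df gf]; set v := y - x; set V := dot v v.
pose psi (s : R) := f (x + s *: v) - L / 2 * V * s ^+ 2.
have dpsi (s : R) :
    is_derive s 1 psi (dot (grad f (x + s *: v)) v - L * V * s).
  have dl := is_derive_line (df (x + s *: v)).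
  have dq : is_derive s 1 (fun r : R => L / 2 * V * r ^+ 2 : R) (L * V * s).
    apply: is_derive_eq.
    by rewrite /GRing.scale /=; field.
  exact: is_deriveB.
have psi_cont : {within `[0, 1], continuous psi}%classic.
  apply: derivable_within_continuous => s _; exact: (dpsi s).(ex_derive).
have [c + ] := MVT ltr01 (fun s _ => dpsi s) psi_cont.
rewrite in_itv /= => /andP[c0 c1]; rewrite /psi subr0 mulr1 scale1r scale0r addr0.
rewrite (_ : x + v = y) ?subrKC // expr1n expr0n /= mulr1 mulr0 subr0.
have : dot (grad f (x + c *: v) - grad f x) v <= L * c * V.
  apply: (le_trans (dot_le_enorm _ _)).
  apply: (@le_trans _ _ (L * enorm (x + c *: v - x) * enorm v)).
    by rewrite ler_wpM2r // enorm_ge0.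
  by rewrite addrC addKr enormZ gtr0_norm // /V -sqr_enorm expr2 !mulrA.
rewrite !dotE; lra.
Qed.

(** The 3/2 is the 1/2 of [smooth_le], read from [x + s *: v] back to [x], plus 1 for moving the
    gradient between these points. Only the order in [s] matters, since [convex_grad] takes [s]
    small. *)
Lemma smooth_ge f L x v s : 0 <= s -> smooth L f ->
  f x + s * dot (grad f x) v - 3 / 2 * L * s ^+ 2 * dot v v <= f (x + s *: v).
Proof.
move=> s0 fL; have := smooth_le (x + s *: v) x fL.
rewrite opprD addNKr !dotE.
have : dot (grad f (x + s *: v) - grad f x) (- v) <= L * s * dot v v.
  apply: (le_trans (dot_le_enorm _ _)).
  apply: (@le_trans _ _ (L * enorm (x + s *: v - x) * enorm (- v))).
    by rewrite ler_wpM2r ?enorm_ge0 //; case: fL.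
  rewrite addrC addKr enormZ ger0_norm // -scaleN1r enormZ normrN1 mul1r.
  by rewrite -sqr_enorm expr2 !mulrA.
rewrite !dotE => /(ler_wpM2l s0); lra.
Qed.

Lemma convexE f x y s : convex f -> 0 <= s -> s <= 1 ->
  f (s *: x + (1 - s) *: y) <= s * f x + (1 - s) * f y.
Proof. by move=> cf s0 s1; apply: (cf (Itv01 s0 s1)); rewrite inE. Qed.

Lemma convex_grad f L x y : convex f -> smooth L f ->
  f x + dot (grad f x) (y - x) <= f y.
Proof.
move=> cf fL; set v := y - x; set c := `|3 / 2 * L * dot v v|.
apply/ler_addgt0Pr => e e0.
have c0 : 0 <= c by exact: normr_ge0.
(* This [s] is at most 1 and makes the error [s * c], left after division by [s], at most [e], even
   when [c] is 0. *)
pose s := e / (c + e).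
have ce : 0 < c + e by rewrite ltr_wpDl.
have s0 : 0 < s by rewrite divr_gt0.
have s1 : s <= 1 by rewrite ler_pdivrMr // mul1r lerDr.
have sc : s * c <= e.
  rewrite /s mulrAC ler_pdivrMr // ler_pM2l //; lra.
have := convexE y x cf (ltW s0) s1.
rewrite (_ : _ + _ = x + s *: v); last first.
  by rewrite /v scalerBl scale1r scalerBr addrCA.
have := smooth_ge x v (ltW s0) fL.
have : 3 / 2 * L * s ^+ 2 * dot v v <= s * e.
  apply: (@le_trans _ _ (s * (s * c))); last by rewrite ler_pM2l.
  rewrite (_ : _ * dot v v = s * (s * (3 / 2 * L * dot v v))); last by ring.
  by rewrite !ler_pM2l // ler_norm.
move=> H1 H2 H3; rewrite -(ler_pM2l s0); lra.
Qed.

(** The value at [x - L^-1 *: D] is bounded below by convexity from [y] and above by smoothness from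
    [x]; this step length maximises the gain. *)
Lemma grad_cocoercive f L x y : 0 < L -> convex f -> smooth L f ->
  dot (grad f x - grad f y) (grad f x - grad f y) <=
  2 * L * (f x - f y - dot (grad f y) (x - y)).
Proof.
move=> L0 cf fL; move DE: (grad f x - grad f y) => D.
have := convex_grad y (x - L^-1 *: D) cf fL.
have := smooth_le x (x - L^-1 *: D) fL.
rewrite (_ : x - L^-1 *: D - x = - (L^-1 *: D)); last by rewrite addrC addKr.
rewrite !(dotDr, dotNl, dotNr, dotZl, dotZr) !mulrN opprK.
have -> : L / 2 * (L^-1 * (L^-1 * dot D D)) = L^-1 * dot D D / 2.
  by field; rewrite gt_eqF.
have eD : L^-1 * dot (grad f x) D - L^-1 * dot (grad f y) D = L^-1 * dot D D.
  by rewrite -mulrBr -dotNl -dotDl DE.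
move=> H1 H2.
suff : L^-1 * dot D D / 2 <= f x - f y - (dot (grad f y) x - dot (grad f y) y).
  by rewrite mulrAC -ler_pdivrMl ?mulr_gt0 // invfM; lra.
lra.
Qed.

Lemma minimizer_grad f L x : 0 < L -> smooth L f -> is_minimizer f x ->
  grad f x = 0.
Proof.
move=> L0 fL fx; apply: dot_eq0; apply/le_anti; rewrite dot_ge0 andbT.
have := smooth_le x (x - L^-1 *: grad f x) fL.
have := fx (x - L^-1 *: grad f x).
rewrite (addrC x) addrK !dotE !mulrN opprK.
have -> : L / 2 * (L^-1 * (L^-1 * dot (grad f x) (grad f x))) =
    L^-1 * dot (grad f x) (grad f x) / 2.
  by field; rewrite gt_eqF.
by move=> H1 H2; rewrite -(ler_pM2l (_ : 0 < L^-1)) ?invr_gt0 // mulr0; lra.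
Qed.

End SmoothConvex.

(** * Gradient and smoothness of a finite average *)

Section Average.
Context {R : realType} {d N : nat}.
Variable F : 'I_N -> 'rV[R]_d -> R.
Implicit Types x y : 'rV[R]_d.

Lemma is_derive_average x v :
  (forall i, differentiable (F i : 'rV[R]_d -> R^o) x) ->
  is_derive x v (average F : 'rV[R]_d -> R^o)
    (dot (N%:R^-1 *: \sum_i grad (F i) x) v).
Proof.
move=> dF.
have -> : (average F : 'rV[R]_d -> R^o) =
    N%:R^-1 \*: \sum_i (F i : 'rV[R]_d -> R^o).
  by apply/funext => z; rewrite /average /= fct_sumE.
have dF' i : is_derive x v (F i : 'rV[R]_d -> R^o) (dot (grad (F i) x) v).
  by rewrite -derive_grad //; apply/derivableP/diff_derivable.
by apply: is_derive_eq; rewrite dotZl dot_suml.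
Qed.

Lemma grad_average x :
  (forall i, differentiable (F i : 'rV[R]_d -> R^o) x) ->
  grad (average F) x = N%:R^-1 *: \sum_i grad (F i) x.
Proof.
move=> dF; apply/rowP => j; rewrite mxE.
rewrite (is_derive_average _ dF).(derive_val).
have delta k : (delta_mx ord0 j : 'rV[R]_d) ord0 k = (k == j)%:R by rewrite mxE.
rewrite /dot (bigD1 j) //= delta eqxx mulr1 [X in _ + X]big1 ?addr0 //.
by move=> k /negbTE kj; rewrite delta kj mulr0.
Qed.

Lemma differentiable_average x :
  (forall i, differentiable (F i : 'rV[R]_d -> R^o) x) ->
  differentiable (average F : 'rV[R]_d -> R^o) x.
Proof.
move=> dF.
have -> : (average F : 'rV[R]_d -> R^o) =
    N%:R^-1 \*: \sum_i (F i : 'rV[R]_d -> R^o).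
  by apply/funext => z; rewrite /average /= fct_sumE.
exact/differentiableZ/differentiable_sum.
Qed.

Lemma smooth_average L : (0 < N)%N -> (forall i, smooth L (F i)) ->
  smooth L (average F).
Proof.
move=> N0 FL; have dF i x := (FL i).1 x.
split=> [x|x y]; first exact: differentiable_average.
rewrite !grad_average // -scalerBr -sumrB enormZ ger0_norm ?invr_ge0 //.
rewrite ler_pdivrMl ?ltr0n //; apply: (le_trans (enorm_sum _)).
rewrite (le_trans (ler_sum _ (fun i _ => (FL i).2 x y))) //.
by rewrite sumr_const card_ord mulr_natl.
Qed.

End Average.


(** * Quadratic growth around the minimizer *)

Section Growth.
Context {R : realType} {d : nat}.
Implicit Types (f : 'rV[R]_d -> R) (x y v : 'rV[R]_d) (L : R).

(** The gap drops by order e^2, with [e] the gradient norm; since [r * u <= e], its square root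
    drops by order e. The short step 1/(4L) gives a drop of 7/16 r per unit of displacement; the
    step 1/L would only give r/4, too little for the factor 6 in [quadratic_growth]. *)
Lemma sqrt_gap_descent f L mu xs x x' : 0 < L -> smooth L f ->
  strongly_convex mu f -> is_minimizer f xs ->
  x' = x - (4 * L)^-1 *: grad f x ->
  Num.sqrt (f x' - f xs) + 7 / 64 / L * Num.sqrt mu * enorm (grad f x) <=
  Num.sqrt (f x - f xs).
Proof.
move=> L0 fL [mu0 cf fmu] fxs x'E.
have gs := minimizer_grad L0 fL fxs.
set r := Num.sqrt mu; set w := Num.sqrt (f x' - f xs).
set u := Num.sqrt (f x - f xs); set e := enorm (grad f x).
have r0 : 0 < r by rewrite sqrtr_gt0.
have rr : r * r = mu by rewrite -expr2 sqr_sqrtr // ltW.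
have uu : u * u = f x - f xs by rewrite -expr2 sqr_sqrtr // subr_ge0.
have ww : w * w = f x' - f xs by rewrite -expr2 sqr_sqrtr // subr_ge0.
have [u0 w0 e0] : [/\ 0 <= u, 0 <= w & 0 <= e].
  by rewrite !sqrtr_ge0.
have ue : r * u <= e.
  rewrite -(@ler_pXn2r _ 2) ?nnegrE ?mulr_ge0 ?(ltW r0) // !expr2.
  have -> : r * u * (r * u) = mu * (u * u) by rewrite -rr; ring.
  rewrite uu.
  have := convex_grad x xs cf fL.
  rewrite -[xs - x]opprB dotNr => gx.
  have {}gx : f x - f xs <= e * enorm (x - xs).
    by apply: (le_trans _ (dot_le_enorm _ _)); lra.
  have := fmu x xs; rewrite gs subr0 -/e => /(ler_wpM2l e0).
  by move: gx => /(ler_wpM2l (ltW mu0)); lra.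
have uw : 7 / 32 / L * (e * e) <= u * u - w * w.
  rewrite uu ww.
  have := smooth_le x x' fL.
  rewrite x'E (addrC x) addrK !dotE !mulrN opprK.
  rewrite -sqr_enorm -/e.
  have -> : L / 2 * ((4 * L)^-1 * ((4 * L)^-1 * e ^+ 2)) = (e * e) / L / 32.
    by field; rewrite gt_eqF.
  have -> : (4 * L)^-1 * e ^+ 2 = (e * e) / L / 4.
    by field; rewrite gt_eqF.
  have : 0 <= e * e / L by rewrite mulr_ge0 ?mulr_ge0 // invr_ge0 ltW.
  lra.
have wu : w <= u.
  rewrite -(@ler_pXn2r _ 2) ?nnegrE // !expr2 -subr_ge0.
  by apply: le_trans uw; rewrite !mulr_ge0 // ?invr_ge0 ltW.
have [e00|ep] := eqVneq e 0; first by rewrite e00 mulr0 addr0.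
have {}ep : 0 < e by rewrite lt_def ep.
rewrite addrC -lerBrDr -(ler_pM2r (_ : 0 < 2 * e)) ?mulr_gt0 //.
apply: (@le_trans _ _ (r * (u * u - w * w))).
  by move/(ler_wpM2l (ltW r0)): uw; lra.
rewrite (_ : _ - _ = (u - w) * (u + w)); last by ring.
rewrite mulrCA ler_wpM2l ?subr_ge0 //.
by move/(ler_wpM2l (ltW r0)): wu; lra.
Qed.

(* The hypothesis only bounds the gradient from below, so growth is obtained by
   iterating a gradient step: each one improves the constant of the linear
   lower bound on the square root of the gap. *)
Lemma quadratic_growth f L mu xs x : 0 < L -> smooth L f ->
  strongly_convex mu f -> is_minimizer f xs ->
  mu * dot (x - xs) (x - xs) <= 6 * (f x - f xs).
Proof.
move=> L0 fL fmu fxs; have [mu0 cf fmu'] := fmu.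
have gs := minimizer_grad L0 fL fxs.
set r := Num.sqrt mu.
have r0 : 0 < r by rewrite sqrtr_gt0.
have rr : r * r = mu by rewrite -expr2 sqr_sqrtr // ltW.
(* A step moves [y] by e/(4L) and lowers the root of the gap by 7/64 r e / L. The two costs fit
   exactly, as (5/12)/4 + 1/192 = 7/64, and the cap 5/12 suffices because 6 (5/12)^2 >= 1. *)
pose a := 5 / 12 * r; pose b := 1 / 192 / L * r * mu.
have b0 : 0 < b by rewrite !mulr_gt0 ?invr_gt0.
have a0 : 0 <= a by rewrite mulr_ge0 // ltW.
have step k y : Num.min a (k%:R * b) * enorm (y - xs) <= Num.sqrt (f y - f xs).
  elim: k y => [|k IH] y.
    by rewrite mul0r min_r // mul0r sqrtr_ge0.
  set s := Num.min a (k%:R * b) in IH.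
  have sa : s <= a by rewrite ge_min lexx.
  have s0 : 0 <= s by rewrite le_min a0 mulr_ge0 // ltW.
  pose y' := y - (4 * L)^-1 *: grad f y.
  have := sqrt_gap_descent L0 fL fmu fxs (erefl y').
  set e := enorm (grad f y) => desc.
  have ey : mu * enorm (y - xs) <= e by have := fmu' y xs; rewrite gs subr0.
  have e0 : 0 <= e by exact: enorm_ge0.
  have yy : enorm (y - xs) <= enorm (y' - xs) + (4 * L)^-1 * e.
    have -> : (4 * L)^-1 * e = enorm ((4 * L)^-1 *: grad f y).
      by rewrite enormZ ger0_norm // invr_ge0 mulr_ge0 // ltW.
    apply: le_trans (enormD _ _).
    by rewrite /y' addrAC subrK.
  have Lr : 0 < L^-1 by rewrite invr_gt0.
  have smin : Num.min a (k.+1%:R * b) <= s + b.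
    rewrite -natr1 mulrDl mul1r /s.
    by case: (leP a (k%:R * b)) => ak; rewrite ge_min ?lexx ?orbT // lerDl ltW.
  apply: (le_trans (ler_wpM2r (enorm_ge0 _) smin)); rewrite mulrDl.
  apply: le_trans desc.
  have h1 := ler_wpM2l s0 yy.
  have h2 := IH y'.
  have h3 : s * ((4 * L)^-1 * e) <= a * ((4 * L)^-1 * e).
    by rewrite ler_wpM2r // mulr_ge0 // invr_ge0 mulr_ge0 // ltW.
  have h4 : b * enorm (y - xs) <= 1 / 192 / L * r * e.
    by rewrite /b -!mulrA !ler_pM2l ?invr_gt0.
  rewrite /a invfM in h3; rewrite invfM in h1; rewrite -/r.
  lra.
have [k kb] : exists k : nat, a <= k%:R * b.
  exists (Num.truncn (a / b)).+1.
  by rewrite -ler_pdivrMr // ltW // truncnS_gt.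
have := step k x; rewrite min_l // => h.
have : (a * enorm (x - xs)) ^+ 2 <= f x - f xs.
  rewrite -[leRHS]sqr_sqrtr ?subr_ge0 //.
  by rewrite ler_pXn2r ?nnegrE ?sqrtr_ge0 // mulr_ge0 ?enorm_ge0 // !mulr_ge0 // ltW.
rewrite exprMn sqr_enorm (_ : a ^+ 2 = 25 / 144 * mu); last by rewrite /a -rr; field.
have := mulr_ge0 (ltW mu0) (dot_ge0 (x - xs)); lra.
Qed.

End Growth.


(** * Transition operators and one stage of SVRG with independent samples *)

Section Operators.
Context {R : realType} {W : Type}.
Implicit Types (op : nat -> (W -> R) -> W -> R) (G : W -> R).

(** Backward composition: the operator of the last step acts first on the observable, as in the
    unfolding of [iterate]. *)
Fixpoint fold_op op (T : nat) G : W -> R :=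
  if T is t.+1 then fold_op op t (op t G) else G.

(** The supermartingale principle in operator form: monotonicity carries the bound at time [T] back
    one step at a time. *)
Lemma fold_op_le op (Phi : nat -> W -> R) (T : nat) :
  (forall t G H, (forall w, G w <= H w) -> forall w, op t G w <= op t H w) ->
  (forall t w, (t < T)%N -> op t (Phi t.+1) w <= Phi t w) ->
  forall G, (forall w, G w <= Phi T w) -> forall w, fold_op op T G w <= Phi 0%N w.
Proof.
move=> opM; elim: T => [|T IH] opPhi G GPhi w /=; first exact: GPhi.
apply: IH => [t w' tT|w']; first by apply: opPhi; rewrite ltnW.
exact: le_trans (opM _ _ _ GPhi _) (opPhi _ _ (ltnSn T)).
Qed.

Lemma fold_op_mono op (T : nat) :
  (forall t G H, (forall w, G w <= H w) -> forall w, op t G w <= op t H w) ->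
  forall G H, (forall w, G w <= H w) ->
  forall w, fold_op op T G w <= fold_op op T H w.
Proof. by move=> opM; elim: T => //= T IH G H GH; apply/IH/opM. Qed.

End Operators.

Section MeanSVRG.
Context {R : realType} {d N : nat}.
Variables (F : 'I_N -> 'rV[R]_d -> R) (eta : R).

Definition svrg_direction (c h x : 'rV[R]_d) (i : 'I_N) : 'rV[R]_d :=
  grad (F i) x - grad (F i) c + h.

(* Current iterate and running average. *)
Local Notation point := ('rV[R]_d * 'rV[R]_d)%type.

Definition svrg_update (c h : 'rV[R]_d) (t : nat) (w : point) (i : 'I_N) : point :=
  let x := w.1 - eta *: svrg_direction c h w.1 i in
  (x, t.+1%:R^-1 *: (x + t%:R *: w.2)).

(* [mean_step] and [mean_stage] are the transition operators of SVRG with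
   independent uniform samples. *)
Definition mean_step (c h : 'rV[R]_d) (t : nat) (G : point -> R) (w : point) : R :=
  N%:R^-1 * \sum_i G (svrg_update c h t w i).

Definition mean_stage (T : nat) (G : 'rV[R]_d -> R) (c : 'rV[R]_d) : R :=
  fold_op (mean_step c (grad (average F) c)) T (fun w => G w.2) (c, 0).

Lemma mean_step_mono c h t G H : (forall w, G w <= H w) ->
  forall w, mean_step c h t G w <= mean_step c h t H w.
Proof.
by move=> GH w; rewrite ler_wpM2l ?invr_ge0 //; apply: ler_sum.
Qed.

Lemma mean_stage_mono T G H : (forall c, G c <= H c) ->
  forall c, mean_stage T G c <= mean_stage T H c.
Proof.
move=> GH c; apply: fold_op_mono => [t G' H'|w //].
exact: mean_step_mono.
Qed.

Section Contraction.
Variables (L mu : R) (xs : 'rV[R]_d).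
Let f := average F.
Let gap x := f x - f xs.
Hypotheses (N0 : (0 < N)%N) (L0 : 0 < L).
Hypotheses (Fcvx : forall i, convex (F i)) (FL : forall i, smooth L (F i)).
Hypotheses (fmu : strongly_convex mu f) (fxs : is_minimizer f xs).

Let fL : smooth L f. Proof. exact: smooth_average. Qed.
Let cf : convex f. Proof. by case: fmu. Qed.
Let Np : 0 < N%:R :> R. Proof. by rewrite ltr0n. Qed.
Let gs : grad f xs = 0. Proof. exact: minimizer_grad fL fxs. Qed.

Let sum_grad x : \sum_i grad (F i) x = N%:R *: grad f x.
Proof.
rewrite /f grad_average => [|i]; last by case: (FL i).
by rewrite scalerA divff ?gt_eqF // scale1r.
Qed.

Let sum_val x : \sum_i F i x = N%:R * f x.
Proof. by rewrite /f /average mulrA divff ?gt_eqF // mul1r. Qed.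

Let sum_cst (z : R) : N%:R * z = \sum_(i < N) z.
Proof. by rewrite sumr_const card_ord mulr_natl. Qed.

(** Co-coercivity at the minimizer: summed over [i], the linear terms form a multiple of
    [grad f xs], which is 0. *)
Lemma sum_grad_gap x :
  \sum_i dot (grad (F i) x - grad (F i) xs) (grad (F i) x - grad (F i) xs) <=
  N%:R * (2 * L * gap x).
Proof.
apply: (le_trans (ler_sum _ (fun i _ => grad_cocoercive _ _ L0 (Fcvx i) (FL i)))).
rewrite -mulr_sumr !sumrB -dot_suml sum_grad gs scaler0 dot0l subr0 !sum_val.
by rewrite /gap -mulrBr mulrCA.
Qed.

(** The direction is [u x i] minus the centred vector [u c i - grad f c], whose second moment is at
    most that of [u c i]. This is the variance reduction: the bound vanishes as both gaps do. *)
Lemma sum_svrg_direction c x :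
  \sum_i dot (svrg_direction c (grad f c) x i) (svrg_direction c (grad f c) x i)
  <= N%:R * (4 * L * (gap x + gap c)).
Proof.
pose v := svrg_direction c (grad f c) x; rewrite -/v.
pose u y i := grad (F i) y - grad (F i) xs.
have vE i : v i = u x i - (u c i - grad f c).
  by apply/rowP => j; rewrite /v /svrg_direction /u !mxE; ring.
have le2 i : dot (v i) (v i) <=
    2 * dot (u x i) (u x i) + 2 * dot (u c i - grad f c) (u c i - grad f c).
  rewrite vE; have := dot_ge0 (u x i + (u c i - grad f c)).
  move: (u c i - _) (u x i) => z y; rewrite !dotE; lra.
apply: (le_trans (ler_sum _ (fun i _ => le2 i))).
rewrite big_split /= -!mulr_sumr.
have ux : \sum_i dot (u x i) (u x i) <= N%:R * (2 * L * gap x) := sum_grad_gap x.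
have uc : \sum_i dot (u c i) (u c i) <= N%:R * (2 * L * gap c) := sum_grad_gap c.
suff : \sum_i dot (u c i - grad f c) (u c i - grad f c) <=
    \sum_i dot (u c i) (u c i).
  move: ux uc; move: (\sum_i _) (\sum_i _) (\sum_i _) => A B D; lra.
have -> : \sum_i dot (u c i - grad f c) (u c i - grad f c) =
    \sum_i dot (u c i) (u c i) - N%:R * dot (grad f c) (grad f c).
  have su : \sum_i u c i = N%:R *: grad f c.
    by rewrite sumrB !sum_grad gs scaler0 subr0.
  have -> : N%:R * dot (grad f c) (grad f c) =
      \sum_i (2 * dot (u c i) (grad f c) - dot (grad f c) (grad f c)).
    rewrite sumrB -mulr_sumr -dot_suml su dotZl sumr_const card_ord -mulr_natl.
    by ring.
  rewrite -sumrB; apply: eq_bigr => i _; move: (u c i) => z.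
  by rewrite !dotE (dotC (grad f c) z); ring.
by rewrite gerBl mulr_ge0 ?dot_ge0 // ltW.
Qed.

Lemma sum_svrg_update c t w : 0 <= eta ->
  \sum_i dot ((svrg_update c (grad f c) t w i).1 - xs)
             ((svrg_update c (grad f c) t w i).1 - xs) <=
  N%:R * (dot (w.1 - xs) (w.1 - xs) - 2 * eta * (1 - 2 * L * eta) * gap w.1
          + 4 * L * eta ^+ 2 * gap c).
Proof.
move=> eta0; case: w => x xb /=.
pose v := svrg_direction c (grad f c) x; rewrite -/v.
have vx : N%:R * gap x <= \sum_i dot (v i) (x - xs).
  rewrite -dot_suml /v /svrg_direction big_split /= sumrB !sum_grad.
  rewrite sumr_const card_ord -(scaler_nat _ (grad f c)) subrK dotZl ler_wpM2l //.
  by have := convex_grad x xs cf fL; rewrite -[xs - x]opprB dotNr /gap; lra.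
have vv := sum_svrg_direction c x; rewrite -/v in vv.
have -> : \sum_i dot (x - eta *: v i - xs) (x - eta *: v i - xs) =
    N%:R * dot (x - xs) (x - xs) - 2 * eta * \sum_i dot (v i) (x - xs)
    + eta ^+ 2 * \sum_i dot (v i) (v i).
  rewrite sum_cst !mulr_sumr -sumrB -big_split.
  apply: eq_bigr => i _; rewrite addrAC; move: (x - xs) (v i) => z z'.
  by rewrite !dotE (dotC z z') /=; ring.
have h1 := ler_wpM2l eta0 vx.
have h2 := ler_wpM2l (sqr_ge0 eta) vv.
lra.
Qed.

Lemma gap_ge0 x : 0 <= gap x.
Proof. by rewrite subr_ge0. Qed.

(** Jensen for the running average. It makes [t * gap] of the average telescope, so past iterates
    need not be remembered. *)
Lemma gap_average t x xb :
  t.+1%:R * gap (t.+1%:R^-1 *: (x + t%:R *: xb)) <= gap x + t%:R * gap xb.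
Proof.
have t0 : 0 < t.+1%:R :> R by rewrite ltr0n.
have := @convexE _ _ f x xb t.+1%:R^-1 cf.
rewrite invr_ge0 invf_le1 // ler1n => /(_ (ltW t0) isT).
have -> : 1 - t.+1%:R^-1 = t.+1%:R^-1 * t%:R :> R.
  by rewrite -(natr1 t); field; rewrite natr1 gt_eqF.
rewrite -scalerA -scalerDr /gap => /(ler_wpM2l (ltW t0)).
move: (t.+1%:R^-1 *: _) => z.
have -> : t.+1%:R * (t.+1%:R^-1 * f x + t.+1%:R^-1 * t%:R * f xb) =
    f x + t%:R * f xb by field; rewrite addrC natr1 gt_eqF.
by rewrite -(natr1 t); lra.
Qed.

(** The factor [a] will hold the contraction of the later stages, so that stages can be chained by
    [fold_op_le]. *)
Lemma mean_stage_contracts (T : nat) (rho a : R) c :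
  0 < eta -> eta * L <= 1 / 4 -> 0 <= a -> (0 < T)%N ->
  6 / mu + T%:R * (4 * L * eta ^+ 2) <=
    rho * (2 * eta * (1 - 2 * L * eta) * T%:R) ->
  mean_stage T (fun x => a * gap x) c <= a * rho * gap c.
Proof.
move=> eta0 etaL a0 T0.
have mu0 : 0 < mu by case: fmu.
set al := 2 * eta * (1 - 2 * L * eta); set be := 4 * L * eta ^+ 2 => Trho.
have al0 : 0 < al by rewrite !mulr_gt0 //; lra.
have Tp : 0 < T%:R :> R by rewrite ltr0n.
pose k := a / (al * T%:R).
have k0 : 0 <= k by rewrite divr_ge0 // mulr_ge0 // ltW.
(* The negative [gap w.1] corrects an index shift: a step gains the gap at x_t, while the average
   receives x_(t+1). What is left of it at time [T] is absorbed by the squared distance through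
   smoothness. *)
pose Phi (t : nat) (w : 'rV[R]_d * 'rV[R]_d) := k * (dot (w.1 - xs) (w.1 - xs)
  + al * (t%:R * gap w.2 - gap w.1) + (T%:R - t%:R) * be * gap c).
have kal : k * (al * T%:R) = a by rewrite /k divfK // mulf_neq0 // gt_eqF.
have step t w : (t < T)%N ->
    mean_step c (grad f c) t (Phi t.+1) w <= Phi t w.
  move=> _; rewrite /mean_step ler_pdivrMl // /Phi -mulr_sumr.
  rewrite [leRHS]mulrCA ler_wpM2l //.
  rewrite !big_split -(sum_cst (_ * be * gap c)) -mulr_sumr.
  have s1 := sum_svrg_update c t w (ltW eta0); rewrite -/al -/be in s1.
  have s2 : al * \sum_i (t.+1%:R * gap (svrg_update c (grad f c) t w i).2
                   - gap (svrg_update c (grad f c) t w i).1) <=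
            al * (N%:R * (t%:R * gap w.2)).
    rewrite ler_pM2l // sum_cst ler_sum // => i _.
    by rewrite lerBlDl gap_average.
  move: s1 s2; set A := \sum_i dot _ _; set B := \sum_i _ => s1 s2.
  rewrite -(natr1 t) /=; lra.
apply: (@le_trans _ _ (Phi 0%N (c, 0))).
  apply: (fold_op_le _ step) => [t G H|[x xb]]; first exact: mean_step_mono.
  rewrite /Phi /= subrr !mul0r addr0 -[leLHS]mul1r -kal.
  have -> : 1 * (k * (al * T%:R) * gap xb) = k * (al * (T%:R * gap xb)) by ring.
  rewrite ler_wpM2l // mulrBr.
  have xL : al * gap x <= dot (x - xs) (x - xs).
    have := smooth_le xs x fL; rewrite gs dot0l -/(gap x) => gx.
    have {}gx : gap x <= L / 2 * dot (x - xs) (x - xs) by rewrite /gap; lra.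
    apply: (@le_trans _ _ (2 * eta * gap x)).
      rewrite ler_wpM2r ?gap_ge0 // /al ler_piMr //; first by lra.
      by have := mulr_gt0 eta0 L0; lra.
    apply: (le_trans (ler_wpM2l _ gx)); first by lra.
    rewrite mulrA ler_piMl ?dot_ge0 //; lra.
  lra.
rewrite /Phi /= mul0r sub0r subr0.
apply: (@le_trans _ _ (k * ((6 / mu + T%:R * be) * gap c))).
  rewrite ler_wpM2l // mulrDl lerD2r.
  have gr := quadratic_growth c L0 fL fmu fxs; rewrite -/(gap c) in gr.
  have := mulr_ge0 (ltW al0) (gap_ge0 c).
  have : dot (c - xs) (c - xs) <= 6 / mu * gap c.
    by rewrite mulrAC ler_pdivlMr // mulrC.
  lra.
apply: (@le_trans _ _ (k * (rho * (al * T%:R) * gap c))).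
  by rewrite ler_wpM2l // ler_wpM2r // gap_ge0.
by rewrite -kal [leLHS](_ : _ = k * (al * T%:R) * rho * gap c) //; ring.
Qed.

End Contraction.
End MeanSVRG.


(** * Expectations over finite distributions and exchangeability *)

Section Expectation.
Context {R : realType}.

Lemma dexpectation_ret (A : Type) (a : A) (g : A -> R) :
  dexpectation (dret a) g = g a.
Proof. by rewrite /dexpectation big_seq1 mul1r. Qed.

Lemma dexpectation_bind (A B : Type) (D : dist R A) (k : A -> dist R B) g :
  dexpectation (dbind D k) g = dexpectation D (fun a => dexpectation (k a) g).
Proof.
rewrite /dexpectation /dbind big_flatten big_map; apply: eq_bigr => wa _.
by rewrite big_map mulr_sumr; apply: eq_bigr => wb _; rewrite mulrA.
Qed.

Lemma dexpectation_uniform (A : Type) (s : seq A) (g : A -> R) :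
  dexpectation (duniform s) g = (size s)%:R^-1 * \sum_(a <- s) g a.
Proof. by rewrite /dexpectation big_map mulr_sumr. Qed.

(** Intertwining of two chains: [A t w] averages over the randomness that the reduced state [w] does
    not record. [resp] is the class of observables for which a step may be exchanged with this
    averaging, so it must be stable under the body. *)
Lemma iterate_intertwine (S W : Type) (body : nat -> S -> dist R S)
    (op : nat -> (W -> R) -> W -> R) (A : nat -> W -> (S -> R) -> R)
    (resp : (S -> R) -> Prop) (T : nat) :
  (forall t G, (t < T)%N -> resp G ->
    resp (fun s => dexpectation (body t s) G)) ->
  (forall t w G, (t < T)%N -> resp G ->
    A t w (fun s => dexpectation (body t s) G) =
    op t (fun w' => A t.+1 w' G) w) ->
  forall w G, resp G ->
  A 0%N w (fun s => dexpectation (iterate body T s) G) =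
  fold_op op T (fun w' => A T w' G) w.
Proof.
elim: T => [|T IH] respB opA w G respG /=.
  by congr (A _ _ _); apply/funext => s; rewrite dexpectation_ret.
under eq_fun do rewrite dexpectation_bind.
rewrite IH; [|by move=> t G' tT; apply: respB; rewrite ltnW
  |by move=> t w' G' tT; apply: opA; rewrite ltnW|exact: respB].
by congr fold_op; apply/funext => w'; rewrite opA.
Qed.

End Expectation.

Section Tuples.
Context {R : realType} {I : finType} {Q : nat}.
Implicit Types (r : Q.-tuple I) (p q : 'I_Q).

Definition set_coord r q i : Q.-tuple I :=
  [tuple (if p == q then i else tnth r p) | p < Q].

Lemma sum_tuple_perm (s : {perm 'I_Q}) (H : Q.-tuple I -> R) :
  \sum_r H [tuple tnth r (s p) | p < Q] = \sum_r H r.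
Proof.
rewrite [RHS](reindex_inj (h := fun r => [tuple tnth r (s p) | p < Q])) //.
move=> r r' rr'; apply: eq_from_tnth => p.
have := congr1 (fun r => tnth r (s^-1%g p)) rr'.
by rewrite !tnth_mktuple permKV.
Qed.

(* Exchanging the fresh value with the value at coordinate [q] is an
   involution. *)
Lemma sum_tuple_resample q (H : I -> Q.-tuple I -> R) :
  (forall i j r, H i (set_coord r q j) = H i r) ->
  #|I|%:R * \sum_r H (tnth r q) r = \sum_i \sum_r H i r.
Proof.
move=> Hq.
pose h (ir : I * Q.-tuple I) := (tnth ir.2 q, set_coord ir.2 q ir.1).
have hK : involutive h.
  case=> i r; rewrite /h /= tnth_mktuple eqxx; congr pair.
  by apply: eq_from_tnth => p; rewrite !tnth_mktuple; case: eqP => [->|].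
rewrite pair_big /= (reindex_inj (inv_inj hK)) /=.
under [RHS]eq_bigr => ir _ do rewrite Hq.
rewrite -(pair_big xpredT xpredT (fun _ r => H (tnth r q) r)) /=.
by rewrite sumr_const mulr_natl.
Qed.

End Tuples.

(** * Pools as slices of the index tuple *)

Section Slices.
Context {I : finType} {Q : nat}.
Variable cap : nat.
Implicit Types (r : Q.-tuple I) (p : 'I_Q).

(* What is left of the [j]-th pool once the first [q] samples are consumed. *)
Definition slice (q j : nat) r : seq I :=
  [seq tnth r p | p <- enum 'I_Q & (p %/ cap == j)%N && (q <= p)%N].

Lemma slice0 j r : (0 < cap)%N ->
  perm_eq (take cap (drop (j * cap) r)) (slice 0 j r).
Proof.
move=> cap0; rewrite -{1}(map_tnth_enum r) -map_drop -map_take.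
apply/perm_map/uniq_perm.
- by rewrite take_uniq // drop_uniq // enum_uniq.
- by rewrite filter_uniq // enum_uniq.
move=> p; rewrite mem_filter mem_enum andbT /= andbT.
rewrite -(mem_map val_inj) map_take map_drop val_enum_ord drop_iota take_iota.
rewrite mem_iota add0n eqn_leq leq_divRL // -(ltnS (p %/ cap)%N) ltn_divLR // mulSn.
by case: p => p /= pQ; move: (j * cap)%N => jc; lia.
Qed.

Lemma perm_slice q j r (s : {perm 'I_Q}) :
  (forall p, ((s p %/ cap == j) && (q <= s p))%N = ((p %/ cap == j) && (q <= p))%N) ->
  perm_eq (slice q j [tuple tnth r (s p) | p < Q]) (slice q j r).
Proof.
move=> sP; rewrite /slice (eq_map (tnth_mktuple _)) (map_comp (tnth r) s).
apply/perm_map/uniq_perm => [||p].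
- by rewrite (map_inj_uniq perm_inj) filter_uniq // enum_uniq.
- by rewrite filter_uniq // enum_uniq.
rewrite -{1}(permKV s p) (mem_map perm_inj) mem_filter.
rewrite [in RHS]mem_filter !mem_enum !andbT.
by rewrite -sP permKV.
Qed.

Lemma slice_cons (q : 'I_Q) r :
  perm_eq (slice q (q %/ cap) r) (tnth r q :: slice q.+1 (q %/ cap) r).
Proof.
rewrite -map_cons; apply/perm_map/uniq_perm => [||p].
- by rewrite filter_uniq // enum_uniq.
- by rewrite /= mem_filter ltnn andbF filter_uniq // enum_uniq.
rewrite inE mem_filter [in RHS]mem_filter !mem_enum !andbT leq_eqVlt.
rewrite (inj_eq val_inj) andb_orr.
rewrite (eq_sym q); case: (eqVneq p q) => [->|_]; first by rewrite eqxx.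
by rewrite andbF.
Qed.

Lemma slice_next q j r : j != (q %/ cap)%N -> slice q.+1 j r = slice q j r.
Proof.
move=> jq; congr map; apply: eq_filter => p; rewrite [in RHS]leq_eqVlt.
case: eqP => //= pj; case: eqP => // qp.
by rewrite -pj -qp eqxx in jq.
Qed.

Lemma slice_set_coord (q : 'I_Q) j r i :
  slice q.+1 j (set_coord r q i) = slice q.+1 j r.
Proof.
apply/eq_in_map => p; rewrite mem_filter tnth_mktuple => /andP[/andP[_ qp] _].
by rewrite (negbTE (_ : p != q)) // -(inj_eq val_inj) gtn_eqF.
Qed.

Lemma slice_nilp q j r :
  nilp (slice q j r) = [forall p : 'I_Q, ~~ ((p %/ cap == j) && (q <= p))%N].
Proof.
rewrite /nilp size_map size_filter -leqn0 leqNgt -has_count.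
apply/hasPn/forallP => [h p|h p _]; last exact: h.
by apply: h; rewrite mem_enum.
Qed.

End Slices.


(** * Equality in law with independent sampling *)

Lemma perm_rem (T : eqType) (x : T) (s s' : seq T) :
  perm_eq s s' -> perm_eq (rem x s) (rem x s').
Proof.
move=> ss'; apply/seq.permP => a.
by rewrite !count_rem (seq.permP ss') (perm_mem ss').
Qed.

Section Coupling.
Context {R : realType} {d : nat}.
Variables (m n C b : nat) (F : 'I_(m * n) -> 'rV[R]_d -> R) (eta : R) (T K : nat).
Local Notation N := (m * n)%N.
Local Notation Q := (T * K)%N.
Local Notation cap := (C - n)%N.
Local Notation state := (state R d N).
Hypotheses (N0 : (0 < N)%N) (Q0 : (0 < Q)%N) (cap0 : (0 < cap)%N).
Hypothesis Qcap : (Q <= cap * m)%N.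

(* The performance counters are ignored and pools only matter as multisets. *)
Definition same_pools (st st' : state) : Prop :=
  [/\ Defs.center st = Defs.center st', active st = active st' &
      forall j, perm_eq (nth [::] (pools st) j) (nth [::] (pools st') j)].

(** Finer than [same_pools]: inside a stage the iterate and the average matter, whereas a new stage
    resets both. *)
Definition same_point (st st' : state) : Prop :=
  [/\ same_pools st st', iterate_point st = iterate_point st' &
      running_average st = running_average st'].

Definition respects (E : state -> state -> Prop) (G : state -> R) : Prop :=
  forall st st', E st st' -> G st = G st'.

Definition handover_state h t (st : state) (i : 'I_N) : state :=
  let k := active st in
  let x := iterate_point st
      - eta *: (grad (F i) (iterate_point st) - grad (F i) (Defs.center st) + h) in
  let xbar := t.+1%:R^-1 *: (x + t%:R *: running_average st) in
  let Rk' := rem i (nth [::] (pools st) k) in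
  let handover : bool := nilp Rk' in
  State (Defs.center st) x xbar (set_nth [::] (pools st) k Rk')
           (k + handover)
           (rounds st + handover)
           (runtime st + 2)
           (vectors st + 2 * handover).

Lemma dexpectation_step h t G st :
  let Rk := nth [::] (pools st) (active st) in
  dexpectation (svrg_step F eta h t st) G =
  if nilp Rk then G st
  else (size Rk)%:R^-1 * \sum_(i <- Rk) G (handover_state h t st i).
Proof.
rewrite /svrg_step; case: ifP => _; first by rewrite dexpectation_ret.
rewrite dexpectation_bind dexpectation_uniform; congr (_ * _).
by apply: eq_bigr => i _; rewrite dexpectation_ret.
Qed.

Lemma handover_state_same h t st st' i : same_point st st' ->
  same_point (handover_state h t st i) (handover_state h t st' i).
Proof.
case=> -[cE aE pE] xE xbE; rewrite /handover_state cE aE xE xbE.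
have pR := perm_rem i (pE (active st')).
split=> //; split=> //= [|j].
  by congr (_ + _)%N; rewrite /nilp (perm_size pR).
by rewrite !nth_set_nth /=; case: ifP.
Qed.

Lemma step_respects h t G : respects same_point G ->
  respects same_point (fun st => dexpectation (svrg_step F eta h t st) G).
Proof.
move=> respG st st' stE; rewrite !dexpectation_step.
have [[_ <- pE] _ _] := stE; have {}pE := pE (active st).
rewrite /nilp (perm_size pE); case: ifP => _; first exact: respG.
rewrite (perm_big _ pE); congr (_ * _); apply: eq_bigr => i _.
exact/respG/handover_state_same.
Qed.

(** The last sample empties its pool even when that slice is short, and the index still moves on;
    [Q %/ cap] would miss this when [cap] does not divide [Q]. *)
Definition active_at (q : nat) : nat :=
  if (q < Q)%N then (q %/ cap)%N else (Q.-1 %/ cap).+1.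

(** Canonical state after [q] draws, in which the drawn samples are the first [q] entries of [r].
    The counters are 0 because [same_pools] ignores them. *)
Definition state_at (q : nat) (c : 'rV[R]_d) (w : 'rV[R]_d * 'rV[R]_d)
    (r : Q.-tuple 'I_N) : state :=
  State c w.1 w.2 (mkseq (fun j => slice cap q j r) m) (active_at q) 0 0 0.

Lemma slice_oversize q (r : Q.-tuple 'I_N) j : (m <= j)%N -> slice cap q j r = [::].
Proof.
move=> mj; apply/nilP; rewrite slice_nilp; apply/forallP => p.
rewrite negb_and neq_ltn ltn_divLR // (leq_trans (ltn_ord p)) //.
by rewrite (leq_trans Qcap) // mulnC leq_mul2r mj orbT.
Qed.

Definition sample_mean (H : Q.-tuple 'I_N -> R) : R :=
  (#|{: Q.-tuple 'I_N}|)%:R^-1 * \sum_r H r.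

Lemma nth_slices q (r : Q.-tuple 'I_N) j :
  nth [::] (mkseq (fun j => slice cap q j r) m) j = slice cap q j r.
Proof.
have [jm|mj] := ltnP j m; first by rewrite nth_mkseq.
by rewrite nth_default ?size_mkseq // slice_oversize.
Qed.

(** Sample [q] triggers a hand-over when it is the last of its slice, either because [cap] divides
    [q.+1] or because the tuple ends. *)
Lemma active_next (q : 'I_Q) (r : Q.-tuple 'I_N) :
  (q %/ cap + nilp (slice cap q.+1 (q %/ cap) r))%N = active_at q.+1.
Proof.
rewrite /active_at slice_nilp; have qQ := ltn_ord q.
case: ifPn => [q1Q|]; last first.
  rewrite -leqNgt => Qq; have -> : Q.-1 = q by lia.
  rewrite (_ : [forall p, _]) ?addn1 //; apply/forallP => p.
  by rewrite negb_and -ltnNge (leq_trans (ltn_ord p)) ?orbT.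
rewrite divnS // addnC; congr (_ + _)%N.
have [dv|ndv] := boolP (cap %| q.+1)%N.
  rewrite (_ : [forall p, _]) //; apply/forallP => p.
  rewrite negb_and -ltnNge ltnS; case: eqP => //= pq.
  have /dvdnP[e qe] := dv.
  by rewrite -ltnS qe -ltn_divLR // pq ltn_divLR // -qe.
apply/eqP; rewrite eqb0 negb_forall; apply/existsP; exists (Ordinal q1Q).
by rewrite negbK /= leqnn andbT divnS // (negbTE ndv).
Qed.

(** A uniform draw from the pool, with multiplicity, is a uniform draw of an unread position in it.
    Transposing that position with [q] changes no pool as a multiset, so all choices contribute the
    same sum. As [state_at q.+1] does not read coordinate [q], [sum_tuple_resample] turns its value
    into an independent sample. *)
Lemma mean_state_step c h t (q : 'I_Q) w G : respects same_point G ->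
  sample_mean (fun r => dexpectation (svrg_step F eta h t (state_at q c w r)) G) =
  mean_step F eta c h t (fun w' => sample_mean (fun r => G (state_at q.+1 c w' r))) w.
Proof.
move=> respG; have qQ := ltn_ord q.
pose k := (q %/ cap)%N.
pose H i r := G (handover_state h t (state_at q c w r) i).
pose P (p : 'I_Q) := ((p %/ cap == k) && (q <= p))%N.
have pool_sum r : dexpectation (svrg_step F eta h t (state_at q c w r)) G =
    #|P|%:R^-1 * \sum_(p | P p) H (tnth r p) r.
  rewrite dexpectation_step /= /active_at qQ nth_slices.
  rewrite ifN; last first.
    rewrite slice_nilp negb_forall; apply/existsP; exists q.
    by rewrite eqxx leqnn.
  rewrite size_map big_map big_filter big_enum_cond /=; congr (_ * _).
  by rewrite size_filter -sum1_count big_enum_cond sum1_card.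
have swap p : P p -> \sum_r H (tnth r p) r = \sum_r H (tnth r q) r.
  move=> Pp.
  rewrite -[LHS](sum_tuple_perm (tperm q p)); apply: eq_bigr => r _.
  rewrite tnth_mktuple tpermR; apply/respG/handover_state_same.
  split=> //; split=> //= j; rewrite !nth_slices; apply: perm_slice => p'.
  by move/andP: Pp => [/eqP pk qp]; case: tpermP => // ->; rewrite pk qp leqnn.
have first_sample i r : tnth r q = i ->
    H i r = G (state_at q.+1 c (svrg_update F eta c h t w i) r).
  move=> ri; apply: respG; rewrite /handover_state /state_at /=.
  have -> : active_at q = k by rewrite /active_at qQ.
  rewrite nth_slices.
  have remE : perm_eq (rem i (slice cap q k r)) (slice cap q.+1 k r).
    by rewrite (perm_trans (perm_rem i (slice_cons cap q r))) //= ri eqxx.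
  split=> //; split=> //= [|j].
    by rewrite -(active_next q r) /nilp (perm_size remE).
  rewrite nth_set_nth /= !nth_slices; case: eqP => [->//|/eqP jk].
  by rewrite slice_next.
rewrite /mean_step /sample_mean -mulr_sumr.
under eq_bigr => r _ do rewrite pool_sum.
rewrite -mulr_sumr exchange_big /= (eq_bigr _ swap) sumr_const.
rewrite [X in _ = _ * (_ * X)]
  (_ : _ = #|'I_N|%:R * \sum_r G (state_at q.+1 c
            (svrg_update F eta c h t w (tnth r q)) r)); last first.
  rewrite (sum_tuple_resample (H := fun i r =>
    G (state_at q.+1 c (svrg_update F eta c h t w i) r))) // => i j r.
  rewrite /state_at; congr (G (State _ _ _ _ _ _ _ _)).
  by apply: eq_map => j'; rewrite slice_set_coord.
rewrite card_ord [RHS]mulrCA mulKf ?pnatr_eq0 -?lt0n //; congr (_ * _).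
rewrite -[X in _ * X = _]mulr_natl mulKf ?pnatr_eq0 -?lt0n; last first.
  by apply/card_gt0P; exists q; rewrite unfold_in /P eqxx leqnn.
by apply: eq_bigr => r _; rewrite (first_sample _ _ erefl).
Qed.

Lemma inner_intertwine c h q0 t w G : (q0 + t <= Q)%N -> respects same_point G ->
  sample_mean (fun r =>
    dexpectation (iterate (svrg_step F eta h) t (state_at q0 c w r)) G) =
  fold_op (mean_step F eta c h) t
    (fun w' => sample_mean (fun r => G (state_at (q0 + t) c w' r))) w.
Proof.
move=> q0t respG.
have := @iterate_intertwine R _ _ (svrg_step F eta h) (mean_step F eta c h)
  (fun t w G => sample_mean (fun r => G (state_at (q0 + t) c w r)))
  (respects same_point) t.
rewrite addn0; apply=> // [t' G' _|t' w' G' t't respG']; first exact: step_respects.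
have q't : (q0 + t' < Q)%N by rewrite (leq_trans _ q0t) // ltn_add2l.
by rewrite addnS; exact: (mean_state_step _ _ _ (Ordinal q't)).
Qed.

Hypothesis Fdiff : forall i x, differentiable (F i : 'rV[R]_d -> R^o) x.

(** The blocks are the fibres of [a], so regrouping yields the whole sum for every [a], and the
    analysis can be done for a fixed partition. *)
Lemma batch_gradientE a x : batch_gradient F a x = grad (average F) x.
Proof.
rewrite grad_average // /batch_gradient; congr (_ *: _).
rewrite [RHS](partition_big a xpredT) //=; apply: eq_bigr => j _.
by apply: eq_bigl => i; rewrite inE.
Qed.

Definition stage_start (a : {ffun 'I_N -> 'I_m}) (st : state) : state :=
  let x := Defs.center st in
  State x x 0 (pools st) (active st)
    (rounds st + b)
    (runtime st + \max_(j < m) #|block a j|)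
    (vectors st + (m + m + 1)).

Definition stage_end (st : state) : state :=
  State (running_average st) (iterate_point st) (running_average st)
    (pools st) (active st) (rounds st) (runtime st) (vectors st).

Lemma dexpectation_stage a l st G :
  dexpectation (stage b F eta T a l st) G =
  dexpectation
    (iterate (svrg_step F eta (batch_gradient F a (Defs.center st))) T
      (stage_start a st)) (G \o stage_end).
Proof.
rewrite /stage dexpectation_bind; congr dexpectation.
by apply/funext => st'; rewrite dexpectation_ret.
Qed.

Lemma iterate_respects E (body : nat -> state -> dist R state) t G :
  (forall t G, respects E G ->
    respects E (fun st => dexpectation (body t st) G)) ->
  respects E G -> respects E (fun st => dexpectation (iterate body t st) G).
Proof.
move=> respB; elim: t G => [|t IH] G respG st st' stE /=.
  by rewrite !dexpectation_ret; exact: respG.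
by rewrite !dexpectation_bind; apply: (IH _ _ _ _ stE); exact: respB.
Qed.

Lemma stage_end_respects G : respects same_pools G ->
  respects same_point (G \o stage_end).
Proof. by move=> respG st st' [[? ? ?] ? ?]; apply: respG. Qed.

Lemma stage_respects a l G : respects same_pools G ->
  respects same_pools (fun st => dexpectation (stage b F eta T a l st) G).
Proof.
move=> respG st st' [cE aE pE]; rewrite !dexpectation_stage cE.
refine (iterate_respects _ (@step_respects _) (stage_end_respects respG) _).
by rewrite /stage_start cE aE.
Qed.

Lemma outer_intertwine a l c G : (l <= K)%N -> respects same_pools G ->
  sample_mean (fun r =>
    dexpectation (iterate (stage b F eta T a) l (state_at 0 c (c, 0) r)) G) =
  fold_op (fun _ => mean_stage F eta T) l
    (fun c' => sample_mean (fun r => G (state_at (l * T) c' (c', 0) r))) c.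
Proof.
move=> lK respG.
have := @iterate_intertwine R _ _ (stage b F eta T a)
  (fun _ => mean_stage F eta T)
  (fun l c G => sample_mean (fun r => G (state_at (l * T) c (c, 0) r)))
  (respects same_pools) l.
rewrite mul0n; apply=> // [l' G' _|l' c' G' l'l respG']; first exact: stage_respects.
have lT : (l' * T + T <= Q)%N.
  by rewrite addnC -mulSn mulnC leq_mul2l (leq_trans l'l lK) orbT.
have respE := stage_end_respects respG'.
transitivity (sample_mean (fun r => dexpectation (iterate (svrg_step F eta
    (batch_gradient F a c')) T (state_at (l' * T) c' (c', 0) r)) (G' \o stage_end))).
  congr (_ * _); apply: eq_bigr => r _; rewrite dexpectation_stage.
  by refine (iterate_respects _ (@step_respects _) respE _).
rewrite inner_intertwine // /mean_stage batch_gradientE.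
congr (fold_op _ _ _ _); apply/funext => w; congr (_ * _).
by apply: eq_bigr => r _; apply: respG'; rewrite mulSn addnC.
Qed.

Lemma sample_mean_cst z : sample_mean (fun=> z) = z.
Proof.
rewrite /sample_mean sumr_const -[X in _ * X]mulr_natl mulKf // pnatr_eq0 -lt0n.
by rewrite card_tuple card_ord expn_gt0 N0.
Qed.

Lemma dexpectation_dsvrg a x0 (g : 'rV[R]_d -> R) :
  dexpectation (duniform (enum {: Q.-tuple 'I_N})) (fun r =>
    dexpectation (iterate (stage b F eta T a) K
      (State x0 x0 0 (initial_pools C r) 0 0 0 0)) (g \o @Defs.center R d N)) =
  fold_op (fun _ => mean_stage F eta T) K g x0.
Proof.
have respg : respects same_pools (g \o @Defs.center R d N).
  by move=> st st' [/= -> _ _].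
rewrite dexpectation_uniform -cardE big_enum /=.
transitivity (sample_mean (fun r => dexpectation (iterate (stage b F eta T a) K
    (state_at 0 x0 (x0, 0) r)) (g \o @Defs.center R d N))).
  congr (_ * _); apply: eq_bigr => r _.
  refine (iterate_respects _ (@stage_respects _) respg _); split=> //= [|j].
    by rewrite /active_at Q0 div0n.
  rewrite nth_slices /initial_pools; have [jm|mj] := ltnP j m.
    by rewrite nth_mkseq // slice0.
  by rewrite nth_default ?size_mkseq // slice_oversize.
rewrite outer_intertwine //; congr fold_op; apply/funext => c.
by rewrite -[RHS]sample_mean_cst.
Qed.

End Coupling.


(** * Bounds on the counters for every outcome *)

Section Surely.
Context {R : realType}.

Lemma surely_ret (A : Type) (a : A) (P : pred A) :
  surely (dret a : dist R A) P = P a.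
Proof. by rewrite /surely /= andbT. Qed.

Lemma surely_bind (A B : Type) (D : dist R A) (k : A -> dist R B) P :
  surely (dbind D k) P = surely D (fun a => surely (k a) P).
Proof.
rewrite /surely /dbind; elim: D => //= wa D IH.
by rewrite all_cat IH; congr (_ && _); rewrite all_map; apply: eq_all.
Qed.

Lemma surely_uniform (A : Type) (s : seq A) P :
  surely (duniform s : dist R A) P = all P s.
Proof. by rewrite /surely all_map; apply: eq_all. Qed.

Lemma surely_sub (A : Type) (D : dist R A) (P P' : pred A) :
  (forall a, P a -> P' a) -> surely D P -> surely D P'.
Proof. by move=> PP'; apply: sub_all => wa; apply: PP'. Qed.

Lemma surely_iterate (A : Type) (body : nat -> A -> dist R A)
    (Inv : nat -> pred A) T a :
  (forall t a, Inv t a -> surely (body t a) (Inv t.+1)) ->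
  Inv 0%N a -> surely (iterate body T a) (Inv T).
Proof.
move=> InvS Inv0; elim: T => [|T IH] /=; first by rewrite /surely /= Inv0.
by rewrite surely_bind; apply: surely_sub IH; apply: InvS.
Qed.

End Surely.

Section Counters.
Context {R : realType} {d : nat}.
Variables (m n C b : nat) (F : 'I_(m * n) -> 'rV[R]_d -> R) (eta : R) (T K : nat).
Local Notation state := (state R d (m * n)).

Definition live (st : state) : nat := count (predC (@nilp _)) (pools st).

(** Amortised bounds: the charge of a hand-over, one round and two vectors, is prepaid by the
    nonempty pool that it empties. *)
Definition counters_le (A B V : nat) (st : state) : bool :=
  [&& rounds st + live st <= A, runtime st <= B &
      vectors st + 2 * live st <= V]%N.

Lemma step_counters A B V h t st : counters_le A B V st ->
  surely (svrg_step F eta h t st) (counters_le A (B + 2) V).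
Proof.
move=> /and3P[rA tB vV]; rewrite /svrg_step.
case: ifPn => [_|Rk].
  by rewrite surely_ret; apply/and3P; split=> //; rewrite (leq_trans tB) // leq_addr.
rewrite surely_bind surely_uniform; apply/allP => i iR; rewrite surely_ret.
set k := active st in Rk iR *; set s := rem i _.
have ks : (k < size (pools st))%N.
  by rewrite ltnNge; apply: contra Rk => ks; rewrite nth_default.
have : (nilp s + count (predC (@nilp _)) (set_nth [::] (pools st) k s) =
    live st)%N.
  rewrite /live -[in RHS](cat_take_drop k (pools st)) (drop_nth [::] ks).
  rewrite set_nthE ks !count_cat /= Rk; case: (nilp s) => /=; lia.
rewrite /counters_le /live /= in rA vV * => liveE.
by apply/and3P; split; lia.
Qed.

Lemma stage_counters A B V a l st : a \in partitions m n -> counters_le A B V st ->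
  surely (stage b F eta T a l st)
    (counters_le (A + b) (B + (n + T * 2)) (V + (m + m + 1))).
Proof.
move=> aP /and3P[rA tB vV]; rewrite /stage surely_bind.
have maxn : (\max_(j < m) #|block a j| <= n)%N.
  apply/bigmax_leqP => j _; move: aP; rewrite mem_enum => /forallP /(_ j).
  by move=> /eqP ->.
move: (\max_(j < m) #|block a j|)%N maxn => M Mn.
set st0 := State _ _ _ _ _ _ _ _.
have /(@surely_iterate R _ (svrg_step F eta (batch_gradient F a (Defs.center st)))
    (fun t => counters_le (A + b) (B + n + t * 2) (V + (m + m + 1))) T) : 
    counters_le (A + b) (B + n + 0 * 2) (V + (m + m + 1)) st0.
  by rewrite /counters_le /live /= in rA tB vV *; apply/and3P; split; lia.
rewrite (addnA B) => it; apply: surely_sub (it _) => [st' inv|t st' inv].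
  by rewrite surely_ret; exact: inv.
by rewrite mulSn (addnC 2%N) addnA; apply: step_counters.
Qed.

Lemma dsvrg_counters x0 J :
  (forall r : (T * K).-tuple 'I_(m * n),
    count (predC (@nilp _)) (initial_pools C r) <= J)%N ->
  surely (dsvrg C b F eta T K x0) (fun st =>
    [&& rounds st <= K * b + J, runtime st <= K * (n + T * 2) &
        vectors st <= K * (m + m + 1) + 2 * J]%N).
Proof.
move=> rJ; rewrite /dsvrg surely_bind surely_uniform; apply/allP => a aP.
rewrite surely_bind surely_uniform; apply/allP => r _.
have /(@surely_iterate R _ (stage b F eta T a)
    (fun l => counters_le (J + l * b) (l * (n + T * 2))
      (2 * J + l * (m + m + 1))) K) : 
    counters_le (J + 0 * b) (0 * (n + T * 2)) (2 * J + 0 * (m + m + 1))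
      (State x0 x0 0 (initial_pools C r) 0 0 0 0).
  by have := rJ r => ?; rewrite /counters_le /live; apply/and3P; split=> /=; lia.
move=> it; apply: surely_sub (it _) => [st'|l st' inv].
  by rewrite /counters_le /= => /and3P[? ? ?]; apply/and3P; split; lia.
have := stage_counters l aP inv; congr (surely _ (counters_le _ _ _)); lia.
Qed.

Lemma live_initial_pools (r : (T * K).-tuple 'I_(m * n)) :
  (0 < C - n)%N -> (0 < T * K)%N ->
  (count (predC (@nilp _)) (initial_pools C r) <= ((T * K).-1 %/ (C - n)).+1)%N.
Proof.
move=> cap0 Q0; rewrite /initial_pools count_map -size_filter.
rewrite -[leqRHS](size_iota 0); apply: uniq_leq_size => [|j].
  by rewrite filter_uniq // iota_uniq.
rewrite mem_filter !mem_iota /= add0n ltnS leq_divRL // => /andP[+ _].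
apply: contraR; rewrite -ltnNge => Qj.
by rewrite /nilp drop_oversize // size_tuple; lia.
Qed.

End Counters.


(** * Choice of the parameters and accuracy of the output *)

Section Rate.
Context {R : realType}.

(** All terms are compared with z = n / (p^2 L). The bound on kappa gives 1/mu <= z/32, so the left
    side is at most 6z/32 + z/64 = 13z/64; as p > 2, the right side is at least (z/4)(15/16) =
    15z/64. *)
Lemma parameters_contract (L mu delta : R) (n : nat) :
  let p := n%:R `^ delta in let eta := (16 * p * L)^-1 in
  (0 < n)%N -> 0 < L -> 0 < mu -> 2 < p ->
  L / mu <= n%:R `^ (1 - 2 * delta) / 32 ->
  6 / mu + n%:R * (4 * L * eta ^+ 2) <=
    2 / p * (2 * eta * (1 - 2 * L * eta) * n%:R).
Proof.
move=> p eta n0 L0 mu0 p2 Lmu.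
have np : 0 < n%:R :> R by rewrite ltr0n.
have p0 : 0 < p by lra.
have npE : n%:R `^ (1 - 2 * delta) = n%:R / p ^+ 2.
  have pp : p ^+ 2 != 0 by rewrite gt_eqF // exprn_gt0.
  apply: (mulIf pp); rewrite divfK // expr2.
  rewrite /p mulrA -!powRD ?(gt_eqF np) ?implybT //.
  by rewrite (_ : 1 - 2 * delta + delta + delta = 1) ?powRr1 // ?ltW //; ring.
rewrite npE in Lmu.
pose z := n%:R / p ^+ 2 / L.
have z0 : 0 < z by rewrite !divr_gt0 // exprn_gt0.
have mz : mu^-1 <= z / 32.
  have -> : mu^-1 = L / mu / L by field; rewrite !gt_eqF.
  rewrite /z; apply: (le_trans (ler_wpM2r _ Lmu)); first by rewrite invr_ge0 ltW.
  by rewrite mulrAC.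
have -> : n%:R * (4 * L * eta ^+ 2) = z / 64.
  by rewrite /eta /z; field; rewrite !gt_eqF.
have -> : 2 / p * (2 * eta * (1 - 2 * L * eta) * n%:R) = z / 4 * (1 - p^-1 / 8).
  by rewrite /eta /z; field; rewrite !gt_eqF.
have p12 : p^-1 <= 1 / 2.
  by rewrite -[leLHS]div1r ler_pdivrMr //; lra.
have := ler_wpM2l (ltW z0) p12; lra.
Qed.

(** The formula for [K] says that [(p / 2) ^+ K] is exactly [g / eps]. *)
Lemma stages_rate (g eps p : R) (K : nat) : 2 < p -> 0 < g / eps ->
  K%:R = (ln (p / 2))^-1 * ln (g / eps) -> (2 / p) ^+ K * (g / eps) = 1.
Proof.
move=> p2 ge0 KE.
have q1 : 1 < p / 2 by lra.
have l0 : 0 < ln (p / 2) by rewrite ln_gt0.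
have qK : 0 < (p / 2) ^+ K by rewrite exprn_gt0 //; lra.
have -> : g / eps = (p / 2) ^+ K.
  apply: ln_inj; rewrite ?posrE // lnXn; last by lra.
  by rewrite -[RHS]mulr_natr KE mulVKf // gt_eqF.
by rewrite -exprMn (_ : _ * _ = 1) ?expr1n //; field; apply/eqP; lra.
Qed.

End Rate.

Section Output.
Context {R : realType} {d : nat}.
Variables (m n C b : nat) (F : 'I_(m * n) -> 'rV[R]_d -> R).

Lemma dsvrg_eps_optimal (eta : R) (K : nat) (L mu rho : R) (xs x0 : 'rV[R]_d) eps :
  (0 < m)%N -> (0 < n)%N -> (0 < K)%N -> (n < C)%N -> (n * K <= (C - n) * m)%N ->
  0 < L -> (forall i, convex (F i)) -> (forall i, smooth L (F i)) ->
  strongly_convex mu (average F) -> is_minimizer (average F) xs ->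
  0 < eta -> eta * L <= 1 / 4 -> 0 <= rho ->
  6 / mu + n%:R * (4 * L * eta ^+ 2) <=
    rho * (2 * eta * (1 - 2 * L * eta) * n%:R) ->
  0 <= eps -> rho ^+ K * (average F x0 - average F xs) <= eps ->
  eps_optimal (average F) xs eps (dsvrg_output C b F eta n K x0).
Proof.
move=> m0 n0 K0 nC Qcap L0 Fc FL fmu fxs eta0 etaL rho0 rhoP eps0 gap_eps.
have N0 : (0 < m * n)%N by rewrite muln_gt0 m0.
have Q0 : (0 < n * K)%N by rewrite muln_gt0 n0.
have cap0 : (0 < C - n)%N by rewrite subn_gt0.
rewrite /eps_optimal /dsvrg_output dexpectation_bind /dsvrg dexpectation_bind.
pose gap x := average F x - average F xs.
have bound a : dexpectation (duniform (enum {: (n * K).-tuple 'I_(m * n)})) (fun r =>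
    dexpectation (iterate (stage b F eta n a) K
      (State x0 x0 0 (initial_pools C r) 0 0 0 0)) (gap \o @Defs.center R d (m * n)))
    <= eps.
  rewrite dexpectation_dsvrg // => [|i x]; last by case: (FL i).
  apply: le_trans gap_eps.
  (* The potential at stage [l] is the gap multiplied by the contraction of the stages still to
     come. *)
  have := @fold_op_le R _ (fun _ => mean_stage F eta n)
    (fun l c => rho ^+ (K - l) * gap c) K.
  rewrite subn0; apply=> [_|l c lK|c].
  - exact: mean_stage_mono.
  - rewrite -(@subnSK l K) // exprSr.
    apply: (@mean_stage_contracts _ _ _ F eta L mu xs N0 L0 Fc FL fmu fxs n rho
      (rho ^+ (K - l.+1)) c eta0 etaL) => //.
    by rewrite exprn_ge0.
  - by rewrite /= subnn mul1r.
rewrite dexpectation_uniform.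
(* An empty list of partitions would give the expectation 0, which [0 <= eps] covers. *)
have [/size0nil ->|s0] := posnP (size (partitions m n)).
  by rewrite big_nil mulr0.
rewrite ler_pdivrMl ?ltr0n //.
have -> : (size (partitions m n))%:R * eps = \sum_(a <- partitions m n) eps.
  by rewrite big_const_seq count_predT iter_addr_0 mulr_natl.
apply: ler_sum => a _; apply: le_trans (bound a).
rewrite dexpectation_bind.
by under eq_fun do under eq_fun do rewrite dexpectation_ret.
Qed.

End Output.


(** * Costs in terms of the number of stages, and conclusion *)

Lemma smoothness_gt0 (R : realType) (d : nat) (f : 'rV[R]_d -> R) (L mu : R) x y :
  smooth L f -> strongly_convex mu f -> f x != f y -> 0 < L.
Proof.
move=> [_ fL] [mu0 _ fmu] fxy.
have e0 : 0 < enorm (x - y).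
  rewrite lt_def enorm_ge0 andbT; apply: contra fxy => /eqP /enorm_eq0 /eqP.
  by rewrite subr_eq0 => /eqP ->.
have := le_trans (fmu x y) (fL x y); rewrite ler_pM2r // => muL.
exact: lt_le_trans muL.
Qed.

(** Since ln(p/2) = delta ln n - ln 2, it suffices that ln n >= 2 ln 2 / delta, which gives the
    threshold [y]. *)
Lemma ln_half_powR (R : realType) (delta : R) : 0 < delta ->
  exists n0 : nat, forall n : nat, (n0 <= n)%N -> 2 < n%:R `^ delta ->
    delta / 2 * ln n%:R <= ln (n%:R `^ delta / 2).
Proof.
move=> delta0; set y := expR (2 * ln 2 / delta); exists (Num.truncn y).+1 => n yn p2.
have yn' : y <= n%:R.
  by apply: (le_trans (ltW (truncnS_gt y))); rewrite ler_nat.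
have : 2 * ln 2 / delta <= ln n%:R.
  by rewrite -[leLHS]expRK ler_ln ?posrE ?expR_gt0 // (lt_le_trans _ yn') ?expR_gt0.
rewrite ler_pdivrMr // ln_div ?posrE ?ln_powR //; last by lra.
by lra.
Qed.

Section Counts.
Context {R : realType} {d : nat}.
Variables (m n C b : nat) (F : 'I_(m * n) -> 'rV[R]_d -> R).

(** One constant serves all three counters. At most (1 + 1/c) K pools are in use, because each slice
    has length at least c n. The rounds account for [b]; the vectors account for 5 + 2/c, as 2m + 1
    <= 3m and each hand-over sends two. *)
Lemma dsvrg_cost (eta c : R) (K : nat) (x0 : 'rV[R]_d) :
  (0 < m)%N -> (0 < n)%N -> (0 < K)%N -> (n < C)%N ->
  0 < c -> c * n%:R <= (C - n)%:R ->
  surely (dsvrg C b F eta n K x0) (fun st =>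
    [&& (rounds st)%:R <= (b%:R + 5 + 2 / c) * K%:R,
        (runtime st)%:R <= (b%:R + 5 + 2 / c) * K%:R * n%:R &
        (vectors st)%:R <= (b%:R + 5 + 2 / c) * K%:R * m%:R]).
Proof.
move=> m0 n0 K0 nC c0 cn; set cost := _ * K%:R.
have cap0 : (0 < C - n)%N by rewrite subn_gt0.
have Q0 : (0 < n * K)%N by rewrite muln_gt0 n0.
have runE : (K * (n + n * 2) = 3 * K * n)%N by ring.
set J := ((n * K).-1 %/ (C - n)).+1.
have /dsvrg_counters : forall r : (n * K).-tuple 'I_(m * n),
    (count (predC (@nilp _)) (initial_pools C r) <= J)%N.
  by move=> r; apply: live_initial_pools.
move=> /(_ R d b F eta x0); apply: surely_sub => st /and3P[rst tst vst].
have np : 0 < n%:R :> R by rewrite ltr0n.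
have K1 : 1 <= K%:R :> R by rewrite ler1n.
have m1 : 1 <= m%:R :> R by rewrite ler1n.
have n1 : 1 <= n%:R :> R by rewrite ler1n.
have b0 : 0 <= b%:R :> R by [].
have JK : J%:R <= K%:R / c + 1 :> R.
  rewrite /J -natr1 lerD2r ler_pdivlMr // -(ler_pM2l np).
  apply: (@le_trans _ _ ((n * K).-1%:R)); last by rewrite -natrM ler_nat leq_pred.
  rewrite mulrCA (mulrC n%:R).
  apply: (le_trans (ler_wpM2l _ cn)) => //.
  by rewrite -natrM ler_nat leq_trunc_div.
have Kc : 0 <= K%:R / c by rewrite divr_ge0 // ltW.
have J1 : J%:R <= (1 + c^-1) * K%:R :> R by lra.
have ci : 0 <= c^-1 by rewrite invr_ge0 ltW.
have cK : 0 <= c^-1 * K%:R by rewrite mulr_ge0.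
have bK : 0 <= b%:R * K%:R :> R by rewrite mulr_ge0.
apply/and3P; split.
- apply: (@le_trans _ _ (K * b + J)%:R); first by rewrite ler_nat.
  by rewrite natrD natrM /cost; lra.
- apply: (@le_trans _ _ (K * (n + n * 2))%:R); first by rewrite ler_nat.
  by rewrite runE !natrM ler_wpM2r // /cost; lra.
- apply: (@le_trans _ _ (K * (m + m + 1) + 2 * J)%:R); first by rewrite ler_nat.
  rewrite natrD !natrM !natrD /cost.
  have h1 : K%:R <= K%:R * m%:R :> R by rewrite ler_peMr.
  have h2 : c^-1 * K%:R <= c^-1 * K%:R * m%:R :> R by rewrite ler_peMr.
  have h3 : 0 <= b%:R * K%:R * m%:R :> R by rewrite mulr_ge0.
  lra.
Qed.

End Counts.
Theorem proposition1 (R : realType) (c delta G : R) (b : nat) :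
  0 < c -> 0 < delta -> delta < 2^-1 -> 0 < G ->
  exists (A : R) (n0 : nat) (eps0 : R), 0 < eps0 /\
  forall s : R, 0 < s ->
  exists (B : R) (n1 : nat),
  forall (d m n C K : nat) (F : 'I_(m * n) -> 'rV[R]_d -> R) (L mu : R)
    (xstar x0 : 'rV[R]_d) (eps : R),
  let f := average F in
  let eta := (16 * n%:R `^ delta * L)^-1 in
  (0 < m)%N -> (m < n)%N ->
  (n < C)%N -> (C < m * n)%N -> c * n%:R <= (C - n)%:R ->
  (forall i, convex (F i)) -> (forall i, smooth L (F i)) ->
  strongly_convex mu f ->
  is_minimizer f xstar ->
  L / mu <= n%:R `^ (1 - 2 * delta) / 32 ->
  2 < n%:R `^ delta ->
  0 < eps ->
  (0 < K)%N ->
  K%:R = (ln (n%:R `^ delta / 2))^-1 * ln ((f x0 - f xstar) / eps) ->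
  (n * K <= (C - n) * m)%N ->
  [/\ eps_optimal f xstar eps (dsvrg_output C b F eta n K x0),
      f x0 - f xstar <= G -> (n0 <= n)%N -> eps <= eps0 ->
      surely (dsvrg C b F eta n K x0) (fun st =>
        [&& (rounds st)%:R <= A * (ln eps^-1 / (delta * ln n%:R)),
            (runtime st)%:R <= A * (n%:R * ln eps^-1 / (delta * ln n%:R)) &
            (vectors st)%:R <= A * (m%:R * ln eps^-1 / (delta * ln n%:R))]) &
      f x0 - f xstar <= G -> (n1 <= n)%N -> eps = n%:R `^ (- s) ->
      surely (dsvrg C b F eta n K x0) (fun st =>
        [&& (rounds st)%:R <= B,
            (runtime st)%:R <= B * n%:R &
            (vectors st)%:R <= B * m%:R])].

Proof.
move=> c0 delta0 _ G0.
have [n0 ln_half] := ln_half_powR delta0.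
set M := b%:R + 5 + 2 / c.
have M0 : 0 < M by rewrite addr_gt0 ?divr_gt0 // ltr_wpDl.
(* One factor 2 comes from [ln_half_powR], the other from ln(G / eps) <= 2 ln(1/eps), which
   [eps <= G^-1] ensures. *)
exists (4 * M), n0, G^-1; split; first by rewrite invr_gt0.
(* Here [eps] may exceed [G^-1], so ln G stays in the constant; it is divided by ln 2 because 1 <= m
   < n gives ln n >= ln 2. *)
move=> s s0; exists (M * (2 / delta * (s + `|ln G| / ln 2))), n0.
move=> d m n C K F L mu xs x0 eps f eta m0 mn nC CN cn Fc FL fmu fxs kappa p2
  eps0 K0 KE Qcap.
have n1 : (0 < n)%N by apply: leq_trans mn.
have np : 0 < n%:R :> R by rewrite ltr0n.
have mu0 : 0 < mu by case: fmu.
(* [ln] is 0 on nonpositive arguments, so a nonpositive gap would force [K = 0]. A positive gap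
   separates [x0] from [xs], whence [0 < L]. *)
have gap0 : 0 < f x0 - f xs.
  rewrite ltNge; apply/negP => gap_le0.
  have ratio_le0 : (f x0 - f xs) / eps <= 0.
    by rewrite mulr_le0_ge0 // invr_ge0 ltW.
  have : K%:R = 0 :> R by rewrite KE (ln0 ratio_le0) mulr0.
  by move/eqP; rewrite pnatr_eq0 -leqn0 leqNgt K0.
have L0 : 0 < L.
  apply: (smoothness_gt0 (smooth_average _ FL) fmu (x := x0) (y := xs)).
    by rewrite muln_gt0 m0.
  by rewrite -subr_eq0 gt_eqF.
set p := n%:R `^ delta in p2 KE eta *.
have eta0 : 0 < eta by rewrite invr_gt0 !mulr_gt0 //; lra.
have ge0 : 0 < (f x0 - f xs) / eps by rewrite divr_gt0.
have etaL : eta * L <= 1 / 4.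
  rewrite /eta invfM mulfVK ?gt_eqF // -div1r ler_pdivrMr; lra.
have cost := dsvrg_cost b F eta x0 m0 n1 K0 nC c0 cn.
have lnp0 : 0 < ln (p / 2) by rewrite ln_gt0; lra.
have lnn : 0 < ln n%:R :> R by rewrite ln_gt0 // ltr1n (leq_ltn_trans m0).
have ln_gap : ln ((f x0 - f xs) / eps) = ln (f x0 - f xs) + ln eps^-1.
  by rewrite lnM ?posrE ?invr_gt0.
have lnK : f x0 - f xs <= G -> (n0 <= n)%N ->
    K%:R * (delta / 2 * ln n%:R) <= ln G + ln eps^-1.
  move=> gapG n0n; apply: (@le_trans _ _ (K%:R * ln (p / 2))).
    by rewrite ler_wpM2l // ln_half.
  rewrite KE mulrAC mulVf ?gt_eqF // mul1r ln_gap lerD2r.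
  by rewrite ler_ln ?posrE.
split.
- apply: (dsvrg_eps_optimal (rho := 2 / p) _ _ _ _ _ _ L0 Fc FL fmu fxs) => //.
  + by rewrite divr_ge0 //; lra.
  + exact: parameters_contract.
  + by rewrite ltW.
  + rewrite -/f -[f x0 - f xs](divfK (lt0r_neq0 eps0)) mulrA.
    by rewrite (stages_rate p2 ge0 KE) mul1r.
- move=> gapG n0n epsG; apply: surely_sub cost => st.
  have KZ : K%:R <= 4 * (ln eps^-1 / (delta * ln n%:R)).
    rewrite mulrA ler_pdivlMr ?mulr_gt0 //.
    have : ln G <= ln eps^-1.
      by rewrite ler_ln ?posrE ?invr_gt0 // -[leLHS]invrK lef_pV2 ?posrE ?invr_gt0.
    by have := lnK gapG n0n; lra.
  have MK : M * K%:R <= 4 * M * (ln eps^-1 / (delta * ln n%:R)).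
    by rewrite mulrAC mulrC ler_wpM2r // ltW.
  case/and3P => rst tst vst; apply/and3P; split.
  + exact: le_trans MK.
  + by rewrite -mulrA mulrCA mulrC; apply: (le_trans tst); rewrite ler_wpM2r.
  + by rewrite -mulrA mulrCA mulrC; apply: (le_trans vst); rewrite ler_wpM2r.
- move=> gapG n0n epsE; apply: surely_sub cost => st.
  have KB : K%:R <= 2 / delta * (s + `|ln G| / ln 2).
    have n2 : 2 <= n%:R :> R by rewrite ler_nat (leq_ltn_trans m0).
    have ln2 : 0 < ln 2 :> R by rewrite ln_gt0 //; lra.
    have ln2n : ln 2 <= ln n%:R :> R by rewrite ler_ln ?posrE.
    have lnG : ln G <= `|ln G| / ln 2 * ln n%:R.
      rewrite mulrAC ler_pdivlMr //; apply: (@le_trans _ _ (`|ln G| * ln 2)).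
        by rewrite ler_wpM2r ?ler_norm // ltW.
      by rewrite ler_wpM2l.
    have lneps : ln eps^-1 = s * ln n%:R.
      by rewrite lnV ?posrE // epsE ln_powR mulNr opprK.
    have := lnK gapG n0n; rewrite lneps => KG.
    rewrite -(ler_pM2r (_ : 0 < delta / 2 * ln n%:R)) ?mulr_gt0 //.
    have -> : 2 / delta * (s + `|ln G| / ln 2) * (delta / 2 * ln n%:R) =
        (s + `|ln G| / ln 2) * ln n%:R by field; rewrite !gt_eqF.
    lra.
  have MK : M * K%:R <= M * (2 / delta * (s + `|ln G| / ln 2)).
    by rewrite ler_wpM2l // ltW.
  case/and3P => rst tst vst; apply/and3P; split.
  + exact: le_trans MK.
  + by apply: (le_trans tst); rewrite ler_wpM2r.
  + by apply: (le_trans vst); rewrite ler_wpM2r.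
Qed.
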